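(* Let $G$ be a plane weighted graph with an even number of vertices, the (real) weight of each edge $e$ of $G$ being denoted by $\omega_e$. Let $e_1=a_1b_1,\ e_2=a_2b_2,\ \ldots,\ e_k=a_kb_k$ ($k\ge 2$) be $k$ independent edges in the boundary of a face $f$ of $G$, such that the vertices $a_1,b_1,a_2,b_2,\ldots,a_k,b_k$ appear in this cyclic order on $f$, and let $X=\{e_i\mid i=1,2,\ldots,k\}$. Then, for any $j=1,2,\ldots,k$, $$M(G)\,M(G-X)=M(G-e_j)\,M(G-X\setminus\{e_j\})+\omega_{e_j}\sum_{1\le i\le k,\ i\ne j}\omega_{e_i}\Big[M(G-b_j-a_i)\,M(G-X-a_j-b_i)-M(G-b_j-b_i)\,M(G-X-a_j-a_i)\Big].$$
   Context: Graphs are finite; a plane graph is a graph together with a fixed embedding in the plane without edge crossings, and each edge carries a non-zero real weight. $M(H)$ denotes the sum of the weights of all perfect matchings of a weighted graph $H$, where the weight of a perfect matching is the product of the weights of its edges (so $M(H)=0$ if $H$ has no perfect matching). Edges are independent if no two of them share a vertex. For a set $Y$ of edges, $G-Y$ is $G$ with the edges in $Y$ deleted (all vertices kept), and $G-e=G-\{e\}$; $G-X\setminus\{e_j\}$ means $G-(X\setminus\{e_j\})$. For vertices $u,v$, $G-u-v$ is $G$ with the vertices $u,v$ and all incident edges deleted; $G-X-u-v$ is obtained by deleting both the edges in $X$ and the vertices $u,v$. Subgraphs inherit edge weights. *)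

(* Defs.v *)
From mathcomp Require Import all_boot all_order all_algebra.
From mathcomp Require Import all_classical all_reals all_analysis.

Set Implicit Arguments.
Unset Strict Implicit.
Unset Printing Implicit Defensive.

Import Order.TTheory GRing.Theory Num.Theory.
Import numFieldNormedType.Exports.

Local Open Scope ring_scope.

(* Parallel edges are allowed; simple graphs are the case of injective [ends]. *)
Record graph := Graph {
  vertex : finType;
  edge : finType;
  ends : edge -> {set vertex};
  card_ends : forall e, #|ends e| = 2%N }.

(* A subgraph of G is a set of vertices together with a set of edges, the
   latter being among the edges of G with both ends in the former; the
   operations below preserve this. *)
Record subgraph (G : graph) := Subgraph {
  vset : {set vertex G};
  eset : {set edge G} }.

Definition whole (G : graph) : subgraph G :=
  Subgraph [set: vertex G] [set: edge G].

Definition del_edges (G : graph) (H : subgraph G) (Y : {set edge G}) :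
    subgraph G :=
  Subgraph (vset H) (eset H :\: Y).

Definition del_vertices (G : graph) (H : subgraph G) (W : {set vertex G}) :
    subgraph G :=
  Subgraph (vset H :\: W) [set x in eset H | [disjoint ends x & W]].

Definition perfect_matching (G : graph) (H : subgraph G)
    (m : {set edge G}) : bool :=
  (m \subset eset H) &&
  [forall v in vset H, #|[set x in m | v \in ends x]| == 1%N].

Definition M (R : realType) (G : graph) (w : edge G -> R) (H : subgraph G) :
    R :=
  \sum_(m : {set edge G} | perfect_matching H m) \prod_(x in m) w x.

Local Open Scope classical_set_scope.

(* The edge x is drawn as the simple arc t |-> arc x t, with t in [0, 1]. *)
Record plane_embedding (R : realType) (G : graph) := PlaneEmbedding {
  pos : vertex G -> R * R;
  arc : edge G -> R -> R * R;
  pos_inj : injective pos;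
  arc_continuous : forall x, {within `[0, 1], continuous (arc x)};
  arc_inj : forall x, {in `[0, 1] &, injective (arc x)};
  arc_ends : forall x, exists u v,
    [/\ ends x = [set u; v]%SET, arc x 0 = pos u & arc x 1 = pos v];
  arc_vertex : forall x t v, t \in `]0, 1[ -> arc x t <> pos v;
  arc_disjoint : forall x y s t, x != y ->
    s \in `]0, 1[ -> t \in `]0, 1[ -> arc x s <> arc y t }.

Section Faces.
Context (R : realType) (G : graph) (P : plane_embedding R G).

Definition drawing : set (R * R) :=
  range (pos P) `|` \bigcup_(x in [set: edge G]) (arc P x @` `[0, 1]).

Definition is_face (f : set (R * R)) : Prop :=
  exists2 z, ~ drawing z & f = connected_component (~` drawing) z.

Definition edge_in_boundary (f : set (R * R)) (x : edge G) : Prop :=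
  arc P x @` `[0, 1] `<=` closure f `\` interior f.

Definition unit_disc : set (R * R) := [set z | z.1 ^+ 2 + z.2 ^+ 2 <= 1].

(* The vertices in the list s appear in this cyclic order on the face f: there
   is a closed (topological) disc which lies in f except that its circumference
   passes through the vertices in s, and meets them in the order of s (in one
   of the two orientations); theta v is the angle at which v is met.
   When f is bounded by a cycle this is the cyclic order along that cycle. In
   general a vertex may occur several times along the boundary of f, and the
   condition is that some choice of occurrences be in the order of s. *)
Definition in_cyclic_order (f : set (R * R)) (s : seq (vertex G)) : Prop :=
  exists (h : R * R -> R * R) (theta : vertex G -> R),
    [/\ {within unit_disc, continuous h},
        set_inj unit_disc h,
        sorted (fun u v => theta u < theta v) s,
        forall v, v \in s ->
          0 <= theta v < 2 * pi /\ h (cos (theta v), sin (theta v)) = pos P v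
      & forall z, unit_disc z ->
          f (h z) \/ exists2 v, v \in s & h z = pos P v].

End Faces.

(* Main.v *)
(* Expanding every sum over matchings according to the edges of X it uses, the
   identity becomes, coefficient by coefficient, a condensation identity for
   H = G - X and the set B of the ends of some of the edges in X, with a in B:
     M(H) M(H-B) = \sum_(v in B, v != a) +- M(H-a-v) M(H-(B-{a,v})).
   Superposing a matching of H-S and one of H-(B-S), each vertex of B is an end
   of a path whose other end is in B too.  Exchanging the two matchings along
   such a path toggles the membership of its two ends in S; this matches the
   terms in which v is linked to a with the left-hand side and cancels the other
   ones in pairs, provided that linked vertices have opposite kinds (a_i or b_i).
   The latter holds since linked pairs do not cross on the face: otherwise two
   disjoint paths outside the disc of the cyclic order, with four radii and four
   circle arcs of it, would draw K5 in the plane.  That is impossible even for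
   connected compact sets instead of arcs: replace them by generic polygonal
   lines, and count the crossings of independent edges modulo 2. *)
From mathcomp Require Import all_boot all_order all_algebra ssrAC zify ring lra.
Require Import Defs.
Set Implicit Arguments.
Unset Strict Implicit.
Unset Printing Implicit Defensive.
Import Order.TTheory GRing.Theory Num.Theory.
Local Open Scope ring_scope.

(** * Superposition of matchings *)

(** Matchings and curves meet in a single statement, the hypothesis [noncrossing] of [FaceEdges]:
    when an arbitrary edge set links [v0] to [v2] and [v1] to [v3], with angles increasing from [v0]
    to [v3], it links [v0] to [v1]. Since it speaks of connectedness only, no path has to be
    extracted from a superposition. On the plane side K5 takes the place of a separation theorem for
    curves: straightening preserves the parity of the crossings, which leaves a finite statement
    about the orientations of five points. A drawn edge then need not be an arc: chains of points
    with arbitrarily small steps inside a compact set suffice. *)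

Section DihedralOrbit.
Variables (T : finType) (f g : T -> T).

Definition step_rel : rel T := fun u v => (v == f u) || (v == g u).

Hypotheses (ff : involutive f) (gg : involutive g).
Hypothesis no_common_fixpoint : forall z, f z = z -> g z <> z.

Let rho := g \o f.

Let rho_inj : injective rho.
Proof. exact: inj_comp (inv_inj gg) (inv_inj ff). Qed.

(** On the orbit of [x] under [rho], of length [N], [f] and [g] act as the reflections [n -> -n] and
    [n -> 1 - n] modulo [N], so the orbit is the whole component. Besides 0 there is one more fixed
    position: [N / 2], fixed by [f], for even [N], and [(N + 1) / 2], fixed by [g], for odd [N].
    Both are [uphalf N]. *)
Lemma fixpoints_of_component x : f x = x ->
  #|[set z | connect step_rel x z & (f z == z) || (g z == z)]| = 2%N.
Proof.
move=> fx; pose N := order rho x; pose p n := iter n rho x.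
have pN : p N = x by exact: iter_order.
have p_inj m n : (m < N)%N -> (n < N)%N -> p m = p n -> m = n.
  by move=> mN nN e; rewrite -(findex_iter mN) -(findex_iter nN) -/(p m) e.
(* Conjugation by [f] inverts [rho], and [f] fixes [x]; so [f (p n)] lies [n] steps before [x] on
   the orbit. *)
have rfr n : iter n rho (f (p n)) = x.
  elim: n => [|n IH]; first exact: fx.
  by rewrite iterSr (_ : rho (f (p n.+1)) = f (p n)) //= /rho /= ff gg.
have fp n : (n <= N)%N -> f (p n) = p (N - n)%N.
  move=> nN; have inj : injective (iter n rho) by elim: n {nN} => // n IH u w /rho_inj/IH.
  by apply: inj; rewrite rfr /p -iterD subnKC.
have gp n : (n <= N)%N -> g (p n) = p (N - n).+1.
  by move=> nN; rewrite -[p _.+1]/(rho (p (N - n)%N)) -fp // /rho /= ff.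
have N1 : (1 < N)%N.
  rewrite ltn_neqAle order_gt0 andbT; apply/eqP => N1.
  by have := no_common_fixpoint fx; rewrite -{1}fx -[g _]/(p 1%N) N1 pN.
have compP z : connect step_rel x z = fconnect rho x z.
  apply/idP/idP.
    case/connectP => q; elim/last_ind: q z => [|q z' IH] z /=; first by move=> _ ->.
    rewrite rcons_path last_rcons => /andP[qp st] ->.
    have := IH _ qp erefl; move: (last x q) st => u + cu.
    have [n nN ->] : exists2 n, (n < N)%N & u = p n.
      by exists (findex rho x u); [exact: findex_max | rewrite /p iter_findex].
    by case/orP => /eqP->; rewrite ?fp ?gp ?(ltnW nN) //; exact: fconnect_iter.
  case/connectP => q /fpathP[n ->] ->; rewrite last_traject.
  elim: n => [|n IH]; first exact: connect0.
  apply: connect_trans IH _; rewrite iterS.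
  by apply: (@connect_trans _ _ (f (iter n rho x))); apply: connect1;
    rewrite /step_rel /= eqxx ?orbT.
have mid : (0 < uphalf N < N)%N by lia.
rewrite (_ : [set _ | _] = [set x; p (uphalf N)]); last first.
  apply/setP => z; rewrite !inE compP.
  apply/andP/orP => [[cz]|[] /eqP->].
  - have [n nN ->] : exists2 n, (n < N)%N & z = p n.
      by exists (findex rho x z); [exact: findex_max | rewrite /p iter_findex].
    have [->|n0] := posnP n; first by left.
    have [-> _|n1] := eqVneq n (uphalf N); first by right.
    case/orP => /eqP; rewrite ?fp ?gp ?(ltnW nN) // => e; exfalso.
      by have := p_inj (N - n)%N n ltac:(lia) nN e; lia.
    have [n2|n2] := ltnP 1 n; first by have := p_inj (N - n).+1 n ltac:(lia) nN e; lia.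
    move: e; rewrite (_ : (N - n).+1 = N) ?pN; last by lia.
    by move=> e; have := p_inj 0%N n ltac:(lia) nN e; lia.
  - by rewrite connect0 fx eqxx.
  - split; first exact: fconnect_iter.
    have [oN|eN] := boolP (odd N); apply/orP; [right|left]; apply/eqP.
      by rewrite gp; [congr p; lia | lia].
    by rewrite fp; [congr p; lia | lia].
rewrite cards2 (_ : x != _) //; apply/eqP => e.
by have := p_inj 0%N (uphalf N) ltac:(lia) ltac:(lia) e; lia.
Qed.

End DihedralOrbit.
Section Superposition.
Variable G : graph.
Implicit Types (F m : {set edge G}) (S B C : {set vertex G}).

Definition adjacent_in F : rel (vertex G) :=
  fun u v => [exists x in F, ends x == [set u; v]].

Definition degree m v := #|[set x in m | v \in ends x]|.

(** Encodes a perfect matching of G - S on all vertices of G: degree 1 off [S] and 0 on [S], the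
    boolean being read as a number. Deleting vertices thus never changes the ambient graph. *)
Definition matches m S := [forall v, degree m v == (v \notin S)].

Lemma adjacent_sym F u v : adjacent_in F u v = adjacent_in F v u.
Proof. by rewrite /adjacent_in setUC. Qed.

Lemma connect_adjacent_sym F : connect_sym (adjacent_in F).
Proof. by apply: sym_connect_sym => u v; exact: adjacent_sym. Qed.

Lemma adjacentU F F' u v :
  adjacent_in (F :|: F') u v = adjacent_in F u v || adjacent_in F' u v.
Proof.
apply/existsP/orP => [[x /andP[]]|[]/existsP[x /andP[xF xE]]].
- by rewrite inE => /orP[] xF xE; [left|right]; apply/existsP; exists x; rewrite xF.
- by exists x; rewrite inE xF.
- by exists x; rewrite inE xF orbT.
Qed.

Lemma adjacent_neq F u v : adjacent_in F u v -> u != v.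
Proof.
case/existsP => x /andP[_ /eqP xE]; have := card_ends x.
by rewrite xE cards2; case: eqP.
Qed.

Section Mate.
Variables (m : {set edge G}) (S : {set vertex G}).
Hypothesis mS : matches m S.

(** Unmatched vertices are their own mates; this makes [mate] an involution with fixpoint set
    [S]. *)
Definition mate v := odflt v [pick u | adjacent_in m v u].

Lemma matches_degree v : degree m v = (v \notin S).
Proof. exact/eqP/(forallP mS). Qed.

Lemma adjacent_unique u v v' : adjacent_in m u v -> adjacent_in m u v' -> v = v'.
Proof.
move=> /[dup] /adjacent_neq uv /existsP[x /andP[xm /eqP xE]].
move=> /[dup] /adjacent_neq uv' /existsP[y /andP[ym /eqP yE]].
have xy : x = y.
  have : (degree m u <= 1)%N by rewrite matches_degree leq_b1.
  by move/card_le1_eqP; apply; rewrite inE ?xm ?ym ?xE ?yE !inE eqxx.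
have : v \in ends y by rewrite -xy xE !inE eqxx orbT.
by rewrite yE !inE eq_sym (negPf uv) => /eqP.
Qed.

Lemma adjacent_notin u v : adjacent_in m u v -> u \notin S.
Proof.
case/existsP => x /andP[xm /eqP xE].
have : (0 < degree m u)%N.
  by apply/card_gt0P; exists x; rewrite inE xm xE !inE eqxx.
by rewrite matches_degree; case: (u \notin S).
Qed.

Lemma adjacent_mate u v : adjacent_in m u v -> mate u = v.
Proof.
rewrite /mate; case: pickP => [v' uv' uv|-> //]; exact: adjacent_unique uv' uv.
Qed.

Lemma mate_in v : v \in S -> mate v = v.
Proof.
move=> vS; rewrite /mate; case: pickP => // u /adjacent_notin.
by rewrite vS.
Qed.

Lemma mate_notin v : v \notin S -> adjacent_in m v (mate v).
Proof.
move=> vS; rewrite /mate; case: pickP => //= no_adj.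
have : (0 < degree m v)%N by rewrite matches_degree vS.
case/card_gt0P => x; rewrite inE => /andP[xm vx].
have /cards2P[a [b [ab xE]]] : #|ends x| == 2%N by rewrite card_ends.
move: vx; rewrite xE !inE => /orP[] /eqP v_eq.
  by have /existsP[] := negbT (no_adj b); exists x; rewrite xm xE v_eq /=.
by have /existsP[] := negbT (no_adj a); exists x; rewrite xm xE v_eq setUC /=.
Qed.

Lemma mateK : involutive mate.
Proof.
move=> v; have [vS|vS] := boolP (v \in S); first by rewrite !mate_in // mate_in.
by apply: adjacent_mate; rewrite adjacent_sym mate_notin.
Qed.

Lemma mate_fix v : (mate v == v) = (v \in S).
Proof.
apply/idP/idP => [/eqP vv|/mate_in->//]; apply: contraT => /mate_notin.
by rewrite vv => /adjacent_neq; rewrite eqxx.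
Qed.

End Mate.

(** Translates components of the superposition into orbits of two involutions, to which
    [fixpoints_of_component] applies. *)
Lemma connect_superposition m m' S S' : matches m S -> matches m' S' ->
  connect (adjacent_in (m :|: m')) =2 connect (step_rel (mate m) (mate m')).
Proof.
move=> mS mS' u v; apply/idP/idP; apply: connect_sub => {}u {}v.
  by rewrite adjacentU => /orP[] uv; apply: connect1;
     rewrite /step_rel ?(adjacent_mate mS uv) ?(adjacent_mate mS' uv) eqxx ?orbT.
have one m1 S1 : matches m1 S1 -> m1 \subset m :|: m' ->
    connect (adjacent_in (m :|: m')) u (mate m1 u).
  move=> m1S m1U; have [uS|uS] := boolP (u \in S1).
    by rewrite (mate_in m1S uS).
  apply: connect1; have /existsP[x /andP[xm1 xE]] := mate_notin m1S uS.
  by apply/existsP; exists x; rewrite (subsetP m1U).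
by case/orP => /eqP->; [apply: (one m S) | apply: (one m' S')];
  rewrite ?subsetUl ?subsetUr.
Qed.

(* In the superposition of a matching missing S and one missing B \ S, each
   vertex of B is an end of a path whose other end is in B as well. *)
Lemma card_component_ends m m' B S x : S \subset B -> matches m S ->
    matches m' (B :\: S) -> x \in B ->
  #|[set z in B | connect (adjacent_in (m :|: m')) x z]| = 2%N.
Proof.
move=> SV0 mS mS' xV0.
have inV0 z : (z \in B) = (mate m z == z) || (mate m' z == z).
  rewrite (mate_fix mS) (mate_fix mS') inE.
  by have := subsetP SV0 z; case: (z \in S); case: (z \in B) => // /(_ isT).
have disj z : mate m z = z -> mate m' z <> z.
  by move=> /eqP + /eqP; rewrite (mate_fix mS) (mate_fix mS') inE => ->.
have : (mate m x == x) || (mate m' x == x) by rewrite -inV0.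
case/orP => /eqP fx.
  rewrite -(fixpoints_of_component (mateK mS) (mateK mS') disj fx).
  apply: eq_card => z; rewrite !inE (connect_superposition mS mS') -inV0.
  exact: andbC.
have disj' z : mate m' z = z -> mate m z <> z by move=> h /disj.
rewrite -(fixpoints_of_component (mateK mS') (mateK mS) disj' fx).
apply: eq_card => z; rewrite !inE setUC (connect_superposition mS' mS).
by rewrite orbC -inV0 andbC.
Qed.

End Superposition.

(** * Exchange of two matchings inside a component *)

Section Swap.
Variable G : graph.
Implicit Types (F m : {set edge G}) (S B C : {set vertex G}).

Definition swap C m m' :=
  [set x in m | ~~ (ends x \subset C)] :|: [set x in m' | ends x \subset C].

Definition component F u := [set v | connect (adjacent_in F) u v].

Lemma swapK C m m' : swap C (swap C m m') (swap C m' m) = m.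
Proof.
apply/setP => x; rewrite !inE; case: (ends x \subset C);
  by rewrite ?andbT ?andbF ?orbF.
Qed.

Lemma swapU C m m' : swap C m m' :|: swap C m' m = m :|: m'.
Proof.
apply/setP => x; rewrite !inE; case: (ends x \subset C);
  by rewrite ?andbT ?andbF ?orbF // orbC.
Qed.

Lemma swap_weight (R : comNzRingType) (w : edge G -> R) C m m' :
  (\prod_(x in swap C m m') w x) * (\prod_(x in swap C m' m) w x) =
  (\prod_(x in m) w x) * (\prod_(x in m') w x).
Proof.
have splitw m1 m2 : \prod_(x in swap C m1 m2) w x =
    (\prod_(x in [set x in m1 | ~~ (ends x \subset C)]) w x) *
    (\prod_(x in [set x in m2 | ends x \subset C]) w x).
  rewrite (bigID (fun x => ends x \subset C)) /= mulrC.
  by congr (_ * _); apply: eq_bigl => x; rewrite !inE;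
    case: (ends x \subset C); rewrite ?andbT ?andbF ?orbF.
have splitm m1 : \prod_(x in m1) w x =
    (\prod_(x in [set x in m1 | ~~ (ends x \subset C)]) w x) *
    (\prod_(x in [set x in m1 | ends x \subset C]) w x).
  rewrite (bigID (fun x => ends x \subset C)) /= mulrC.
  by congr (_ * _); apply: eq_bigl => x; rewrite inE.
by rewrite !splitw (splitm m) (splitm m'); ring.
Qed.

Lemma component_edge F u x v : x \in F -> v \in ends x ->
  (ends x \subset component F u) = (v \in component F u).
Proof.
move=> xF vx; apply/idP/idP => [/subsetP->//|]; rewrite inE => cv.
apply/subsetP => t tx; rewrite inE.
have [->//|vt] := eqVneq t v.
apply: connect_trans cv (connect1 _); apply/existsP; exists x.
rewrite xF eq_sym eqEcard card_ends cards2 eq_sym vt andbT.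
by apply/subsetP => y; rewrite !inE => /orP[] /eqP->.
Qed.

Lemma degree_swap m m' u v : degree (swap (component (m :|: m') u) m m') v =
  if v \in component (m :|: m') u then degree m' v else degree m v.
Proof.
set C := component _ _; rewrite -[RHS](fun_if (fun n => degree n v)) /degree.
apply: eq_card => x; rewrite !inE.
have [vx|] := boolP (v \in ends x); rewrite ?andbT ?andbF //.
have : x \in m :|: m' -> (ends x \subset C) = connect (adjacent_in (m :|: m')) u v.
  by move=> xm; rewrite (component_edge u xm vx) inE.
rewrite inE; case: ifP => _; case: (x \in m); case: (x \in m') => /= memC;
  by rewrite ?memC.
Qed.

(** Inside the component [C] the sets [S] and [B :\: S] exchange roles, and by [card_component_ends]
    [C] meets [B] only in [u] and [v]; so membership in [S] is toggled exactly there. *)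
Lemma matches_swap m m' S S1 B u v : S \subset B -> matches m S ->
    matches m' (B :\: S) -> u \in B -> v \in B -> u != v ->
    connect (adjacent_in (m :|: m')) u v ->
    (forall z, (z \in S1) = (z \in S) (+) (z \in [set u; v])) ->
  let C := component (m :|: m') u in
  matches (swap C m m') S1 /\ matches (swap C m' m) (B :\: S1).
Proof.
move=> SB mS mS' uB vB uv cuv S1E C.
have ends2 : [set z in B | connect (adjacent_in (m :|: m')) u z] = [set u; v].
  apply/esym/eqP; rewrite eqEcard (card_component_ends SB mS mS' uB) cards2 uv andbT.
  by apply/subsetP => z; rewrite !inE => /orP[] /eqP->; rewrite ?uB ?vB //= connect0.
have uvC z : (z \in [set u; v]) = (z \in B) && (z \in C).
  by rewrite -ends2 !inE.
have degm z := matches_degree mS z; have degm' z := matches_degree mS' z.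
have SBz z : z \in S -> z \in B by apply: (subsetP SB).
split; apply/forallP => z.
  rewrite degree_swap degm degm' S1E uvC in_setD -/C.
  move: (SBz z); case: (z \in C); case: (z \in S) => [/(_ isT)->|_] //=;
  by case: (z \in B).
have -> : C = component (m' :|: m) u by rewrite setUC.
rewrite degree_swap degm degm' !in_setD S1E uvC [m' :|: m]setUC -/C.
move: (SBz z); case: (z \in C); case: (z \in S) => [/(_ isT)->|_] //=;
by case: (z \in B).
Qed.

End Swap.

(** * The condensation identity for coloured vertices *)

Section Condensation.
Variables (R : numDomainType) (G : graph) (w : edge G -> R) (A : {set edge G}).
Implicit Types (S B : {set vertex G}) (p : {set edge G} * {set edge G}).

Definition matching_sum S : R :=
  \sum_(m : {set edge G} | (m \subset A) && matches m S) \prod_(x in m) w x.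

Definition pair_weight p : R := (\prod_(x in p.1) w x) * (\prod_(x in p.2) w x).

Definition superposition B S p :=
  [&& p.1 \subset A, p.2 \subset A, matches p.1 S & matches p.2 (B :\: S)].

Definition linked p u v := connect (adjacent_in (p.1 :|: p.2)) u v.

Definition linked_sum B S u v : R :=
  \sum_(p | superposition B S p && linked p u v) pair_weight p.

Lemma matching_sumM B S : matching_sum S * matching_sum (B :\: S) =
  \sum_(p | superposition B S p) pair_weight p.
Proof.
rewrite /matching_sum big_distrlr /= pair_big /=; apply: eq_bigl => p.
by rewrite /superposition /= andbACA -!andbA.
Qed.

Lemma linked_sumC B S u v : linked_sum B S u v = linked_sum B S v u.
Proof. by apply: eq_bigl => p; rewrite /linked connect_adjacent_sym. Qed.

(** The map [phi] is a weight-preserving involution: a swap keeps the union of the two matchings,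
    hence also the component along which to swap back. *)
Lemma linked_sum_swap B S S1 u v : S \subset B -> u \in B -> v \in B -> u != v ->
    (forall z, (z \in S1) = (z \in S) (+) (z \in [set u; v])) ->
  linked_sum B S u v = linked_sum B S1 u v.
Proof.
move=> SB uB vB uv S1E.
pose C p := component (p.1 :|: p.2) u.
pose phi p := (swap (C p) p.1 p.2, swap (C p) p.2 p.1).
have phiU p : (phi p).1 :|: (phi p).2 = p.1 :|: p.2 by exact: swapU.
have CE p : C (phi p) = C p by rewrite /C phiU.
have phiK : involutive phi.
  by move=> p; rewrite {1}/phi CE !swapK -surjective_pairing.
have swapA D (m m' : {set edge G}) : m \subset A -> m' \subset A -> swap D m m' \subset A.
  move=> mA m'A; apply/subsetP => x; rewrite !inE.
  by case/orP => /andP[xm _]; [exact: (subsetP mA) | exact: (subsetP m'A)].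
have half S' S1' p : S' \subset B ->
    (forall z, (z \in S1') = (z \in S') (+) (z \in [set u; v])) ->
    superposition B S' p && linked p u v ->
    superposition B S1' (phi p) && linked (phi p) u v.
  move=> S'B S1'E /andP[/and4P[p1 p2 m1 m2] l].
  rewrite /linked phiU -/(linked p u v) l andbT; apply/and4P.
  by have [h1 h2] := matches_swap S'B m1 m2 uB vB uv l S1'E; rewrite !swapA.
rewrite [LHS](reindex_onto phi phi) => [|p _]; last exact: phiK.
apply: eq_big => [p|p _]; last exact: swap_weight.
rewrite phiK eqxx andbT; apply/idP/idP.
  by move/(half S S1 _ SB S1E); rewrite phiK.
apply: (half S1 S p) => [|z]; last by rewrite S1E addbK.
apply/subsetP => z; rewrite S1E in_set2.
have := subsetP SB z; case: (z \in S) => [/(_ isT)-> //|_ /=].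
by case/orP => /eqP->.
Qed.

(** In each superposition exactly one vertex of [B] other than [u] is linked to [u]; the pairs are
    sorted by this vertex. *)
Lemma sum_linked B S u : S \subset B -> u \in B ->
  \sum_(p | superposition B S p) pair_weight p =
  \sum_(v in B :\ u) linked_sum B S u v.
Proof.
move=> SB uB; rewrite /linked_sum (exchange_big_dep (superposition B S)) /=; last first.
  by move=> v p _ /andP[].
apply: eq_bigr => p sp; have /and4P[_ _ m1 m2] := sp.
have : #|[set v in B | linked p u v] :\ u| = 1%N.
  have := card_component_ends SB m1 m2 uB.
  by rewrite (cardsD1 u) inE uB connect0 => -[].
move/eqP/cards1P => [v vE]; rewrite (eq_bigl (pred1 v)) ?big_pred1_eq // => z.
by rewrite -[pred1 v z]/(z == v) -in_set1 -vE !inE sp /= andbA.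
Qed.

(** The colouring hypothesis is phrased for edge sets whose components meet [B] in pairs, so that
    planarity can supply it without reference to matchings. *)
Lemma condensation B (a : vertex G) (c : vertex G -> bool) : a \in B ->
    (forall F, {in B, forall u, #|[set z in B | connect (adjacent_in F) u z]| = 2%N} ->
       {in B &, forall u v, u != v -> connect (adjacent_in F) u v -> c u != c v}) ->
  matching_sum set0 * matching_sum B =
  \sum_(v in B :\ a) (-1) ^+ (c v == c a) *
    (matching_sum [set a; v] * matching_sum (B :\: [set a; v])).
Proof.
move=> aB alt.
have avB v : v \in B :\ a -> [set a; v] \subset B.
  by rewrite !inE => /andP[_ vB]; apply/subsetP => z; rewrite !inE => /orP[]/eqP->.
have opp S u v : S \subset B -> u \in B -> v \in B -> u != v -> c u == c v ->
    linked_sum B S u v = 0.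
  move=> SB uB vB uv cuv; rewrite /linked_sum big1 // => p /andP[/and4P[_ _ m1 m2] l].
  have := alt (p.1 :|: p.2) (fun u uB => card_component_ends SB m1 m2 uB) u v uB vB uv l.
  by rewrite cuv.
rewrite -[in matching_sum B](setD0 B) matching_sumM (sum_linked (sub0set _) aB).
(* the pairs in which v is linked to a contribute the left-hand side; swapping
   along the path from v pairs off the others with opposite signs *)
have split_v v : v \in B :\ a ->
    matching_sum [set a; v] * matching_sum (B :\: [set a; v]) =
    linked_sum B set0 a v +
    \sum_(u in B :\ a :\ v) linked_sum B [set a; v] v u.
  move=> vBa; have /setD1P[va vB] := vBa.
  rewrite matching_sumM (sum_linked (avB _ vBa) vB) (bigD1 a) /=; last first.
    by rewrite !inE eq_sym va.
  rewrite linked_sumC; congr (_ + _).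
    apply/esym/linked_sum_swap; rewrite ?sub0set // 1?eq_sym //.
    by move=> z; rewrite in_set0.
  by apply: eq_bigl => u; rewrite !in_setD1 -andbA [(_ \in _) && _]andbC.
rewrite [RHS](eq_bigr (fun v => linked_sum B set0 a v + (-1) ^+ (c v == c a) *
    \sum_(u in B :\ a :\ v) linked_sum B [set a; v] v u)); last first.
  move=> v vBa; rewrite split_v // mulrDr; congr (_ + _).
  have /setD1P[va vB] := vBa.
  have [cva|_] := boolP (c v == c a); last by rewrite mul1r.
  by rewrite (opp set0 a v) ?mulr0 ?sub0set // eq_sym.
rewrite big_split /= -[LHS]addr0; congr (_ + _); apply/esym.
(* The cancellation in pairs is shown by exchanging the two summation variables, which avoids
   choosing an order within each pair; it suffices since 2 is not a zero divisor. *)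
set Z := \sum_(v in _) _; suff : Z = - Z.
  by move/eqP; rewrite -addr_eq0 -mulr2n mulrn_eq0 /= => /eqP.
rewrite {1}/Z; under eq_bigr do rewrite big_distrr /=.
rewrite (exchange_big_dep (mem (B :\ a))) /=; last first.
  by move=> v u _; rewrite !inE => /and3P[_ -> ->].
rewrite /Z -sumrN; apply: eq_bigr => u uBa; rewrite big_distrr -sumrN /=.
apply: eq_big => [v|v].
  by move: uBa; rewrite !in_setD1 => /andP[-> ->]; rewrite !andbT [u == v]eq_sym andbC.
case/andP => vBa; rewrite !inE => /and3P[uv ua uB]; have /setD1P[va vB] := vBa.
have swp : linked_sum B [set a; v] v u = linked_sum B [set a; u] u v.
  rewrite (linked_sum_swap (S1 := [set a; u]) (avB _ vBa)) // 1?eq_sym //.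
    exact: linked_sumC.
  move=> z; rewrite !inE; case: (eqVneq z a) => [->|_]; rewrite /= ?(negPf va).
    by rewrite eq_sym (negPf va) eq_sym (negPf ua).
  by case: (eqVneq z v) => [->|_]; rewrite /= ?addFb // eq_sym (negPf uv).
rewrite swp; have [cuv|cuv] := eqVneq (c u) (c v).
  by rewrite opp ?mulr0 ?oppr0 ?avB // cuv.
move: cuv; case: (c u); case: (c v); case: (c a) => //= _;
  by rewrite ?expr0 ?expr1 ?mul1r ?mulN1r ?opprK.
Qed.

End Condensation.

(** * Edges on a face *)

Section Alternation.
Variables (R : realDomainType) (G : graph) (k : nat).
Variables (a b : 'I_k -> vertex G) (theta : vertex G -> R).
Local Notation s := (flatten [seq [:: a i; b i] | i <- enum 'I_k]).
Hypothesis theta_sorted : sorted (fun u v => theta u < theta v) s.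

Definition end_vertices (J : {set 'I_k}) := [set a i | i in J] :|: [set b i | i in J].

Lemma theta_order : (forall i, theta (a i) < theta (b i)) /\
  (forall i j : 'I_k, (i < j)%N -> theta (b i) < theta (a j)).
Proof.
have tr : transitive (fun u v => theta u < theta v) by move=> ? ? ?; exact: lt_trans.
move: theta_sorted; rewrite sorted_pairwise //.
have key (l : seq 'I_k) :
    pairwise (fun u v => theta u < theta v) (flatten [seq [:: a i; b i] | i <- l]) ->
    all (fun i => theta (a i) < theta (b i)) l &&
    pairwise (fun i j => theta (b i) < theta (a j)) l.
  elim: l => //= i l IH /andP[/andP[ab _] /andP[bl /IH/andP[-> ->]]].
  rewrite ab /= andbT; apply/allP => j jl; apply: (allP bl).
  by apply/flattenP; exists [:: a j; b j]; rewrite ?mem_head //; exact: map_f.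
case/key/andP => /allP ab /pairwiseP ba; split=> [i|i j ij].
  by apply: ab; rewrite mem_enum.
have := ba i i j; rewrite !inE size_enum_ord !nth_ord_enum; exact.
Qed.

(** Together with the next three lemmas this turns every comparison of angles into one of indices,
    which [lia] decides. *)
Lemma theta_aa (i j : 'I_k) : (theta (a i) < theta (a j)) = (i < j)%N.
Proof.
have [ab ba] := theta_order.
have lt (x y : 'I_k) : (x < y)%N -> theta (a x) < theta (a y).
  by move=> xy; exact: lt_trans (ab x) (ba _ _ xy).
case: (ltngtP i j) => [/lt-> //|/lt ji|/ord_inj->]; last by rewrite ltxx.
by apply: negbTE; rewrite -leNgt ltW.
Qed.

Lemma theta_bb (i j : 'I_k) : (theta (b i) < theta (b j)) = (i < j)%N.
Proof.
have [ab ba] := theta_order.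
have lt (x y : 'I_k) : (x < y)%N -> theta (b x) < theta (b y).
  by move=> xy; exact: lt_trans (ba _ _ xy) (ab y).
case: (ltngtP i j) => [/lt-> //|/lt ji|/ord_inj->]; last by rewrite ltxx.
by apply: negbTE; rewrite -leNgt ltW.
Qed.

Lemma theta_ba (i j : 'I_k) : (theta (b i) < theta (a j)) = (i < j)%N.
Proof.
have [ab ba] := theta_order.
have [/ba-> //|ji] := ltnP i j; apply: negbTE; rewrite -leNgt ltW //.
by apply: le_lt_trans (ab i); rewrite leNgt theta_aa -leqNgt.
Qed.

Lemma theta_ab (i j : 'I_k) : (theta (a i) < theta (b j)) = (i <= j)%N.
Proof.
have [ab ba] := theta_order.
have [ij|/ba ji] := leqP i j; last by apply: negbTE; rewrite -leNgt ltW.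
by apply: le_lt_trans (ab j); rewrite leNgt theta_aa -leqNgt.
Qed.

Lemma a_inj : injective a.
Proof.
by move=> i j ij; apply: ord_inj; have := theta_aa i j; have := theta_aa j i;
  rewrite ij ltxx; case: ltngtP.
Qed.

Lemma b_inj : injective b.
Proof.
by move=> i j ij; apply: ord_inj; have := theta_bb i j; have := theta_bb j i;
  rewrite ij ltxx; case: ltngtP.
Qed.

Lemma a_neq_b i j : a i != b j.
Proof.
apply/eqP => ij; have := theta_ab i j; have := theta_ba j i.
by rewrite ij ltxx; case: ltngtP.
Qed.

Lemma mem_a_end_vertices i (J : {set 'I_k}) : (a i \in end_vertices J) = (i \in J).
Proof.
rewrite inE (mem_imset _ _ a_inj) orbC; case: imsetP => // -[j _ /eqP].
by rewrite (negPf (a_neq_b _ _)).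
Qed.

Lemma mem_b_end_vertices i (J : {set 'I_k}) : (b i \in end_vertices J) = (i \in J).
Proof.
rewrite inE (mem_imset _ _ b_inj); case: imsetP => // -[j _ /eqP].
by rewrite eq_sym (negPf (a_neq_b _ _)).
Qed.

Lemma end_verticesP (J : {set 'I_k}) v : reflect (exists2 i, i \in J & v = a i \/ v = b i)
  (v \in end_vertices J).
Proof.
apply: (iffP setUP) => [[]/imsetP[i iJ ->]|[i iJ [->|->]]].
- by exists i; [|left].
- by exists i; [|right].
- by left; exact: imset_f.
- by right; exact: imset_f.
Qed.

Lemma big_end_vertices (T : Type) (idx : T) (op : Monoid.com_law idx)
    (J : {set 'I_k}) (F : vertex G -> T) :
  \big[op/idx]_(z in end_vertices J) F z =
  \big[op/idx]_(i in J) op (F (a i)) (F (b i)).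
Proof.
rewrite (bigID (mem [set a i | i in J])) /=.
rewrite (eq_bigl (mem [set a i | i in J])) => [|z]; last first.
  by rewrite /= in_setU andbC; case: (z \in [set a i | i in J]).
rewrite [X in op _ X](eq_bigl (mem [set b i | i in J])) => [|z]; last first.
  rewrite /= in_setU; case: imsetP => [[i _ ->]|_] /=; last by rewrite andbT.
  by apply/esym/imsetP => -[j _ /eqP]; rewrite (negPf (a_neq_b _ _)).
rewrite !big_imset /=; [|by move=> ? ? _ _; exact: b_inj|by move=> ? ? _ _; exact: a_inj].
by rewrite -big_split.
Qed.

(** Only the pairs [a i], [b i] of which [D] contains a single end affect the parity. *)
Lemma odd_between (J : {set 'I_k}) (D : {set vertex G}) : D \subset end_vertices J ->
  odd #|D| = \big[addb/false]_(i in J) ((a i \in D) (+) (b i \in D)).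
Proof.
move=> DJ; rewrite -sum1_card.
rewrite (_ : (\sum_(z in D) 1)%N = \sum_(z in end_vertices J) (z \in D))%N; last first.
  rewrite [RHS]big_mkcond /= big_mkcond /=; apply: eq_bigr => z _.
  by have := subsetP DJ z; case: (z \in D) => [->//|_]; case: ifP.
rewrite (big_morph odd oddD (erefl : odd 0 = false)) big_end_vertices.
by apply: eq_bigr => i _; rewrite !oddb.
Qed.

(* Two linked vertices of the same kind would be separated by an odd number of
   vertices, one of which would be linked to a vertex outside. *)
Lemma linked_alternate (F : {set edge G}) (J : {set 'I_k}) :
    (forall v0 v1 v2 v3, [/\ v0 \in s, v1 \in s, v2 \in s & v3 \in s] ->
      [/\ theta v0 < theta v1, theta v1 < theta v2 & theta v2 < theta v3] ->
      connect (adjacent_in F) v0 v2 -> connect (adjacent_in F) v1 v3 ->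
      connect (adjacent_in F) v0 v1) ->
    {in end_vertices J, forall u, #|[set z in end_vertices J | connect (adjacent_in F) u z]| = 2%N} ->
  {in end_vertices J &, forall u v, u != v -> connect (adjacent_in F) u v ->
     (u \in codom a) != (v \in codom a)}.
Proof.
have [B BE] : {B | B = end_vertices J} by exists (end_vertices J).
rewrite -BE => nc two u v uB vB uv cuv; apply/negP => /eqP cuv'.
have Bs z : z \in B -> z \in s.
  rewrite BE => /end_verticesP[i _ zi]; apply/flattenP; exists [:: a i; b i].
    by apply: map_f; rewrite mem_enum.
  by case: zi => ->; rewrite !inE eqxx ?orbT.
have theta_inj : {in B &, injective theta}.
  move=> x y; rewrite BE => /end_verticesP[i _ [->|->]] /end_verticesP[j _ [->|->]] e.
  - by have := theta_aa i j; have := theta_aa j i; rewrite e ltxx; case: ltngtP => // /ord_inj->.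
  - by have := theta_ab i j; have := theta_ba j i; rewrite e ltxx; case: ltngtP.
  - by have := theta_ab j i; have := theta_ba i j; rewrite e ltxx; case: ltngtP.
  - by have := theta_bb i j; have := theta_bb j i; rewrite e ltxx; case: ltngtP => // /ord_inj->.
wlog luv : u v uB vB uv cuv cuv' / theta u < theta v.
  move=> wl; have [lt|gt|e] := ltgtP (theta u) (theta v); first exact: wl uv cuv cuv' lt.
    by apply: (wl v u) => //; rewrite 1?eq_sym // connect_adjacent_sym.
  by rewrite (theta_inj _ _ uB vB e) eqxx in uv.
pose D := [set z in B | theta u < theta z < theta v].
have DB : D \subset B by apply/subsetP => z; rewrite in_set => /andP[].
have ends_u z : z \in B -> connect (adjacent_in F) u z -> z = u \/ z = v.
  move=> zB cuz; have := two u uB.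
  rewrite (cardsD1 u) (cardsD1 v) in_setD1 !in_set uB vB connect0 cuv eq_sym uv.
  move=> -[] /eqP; rewrite cards_eq0 => /eqP /setP /(_ z).
  rewrite !in_setD1 in_set in_set0 zB cuz !andbT.
  by case: (eqVneq z u) => [->|zu]; [left | rewrite andbT => /negbFE/eqP; right].
(* A link from [D] to a vertex beyond [u] or [v] would cross the link from [u] to [v]; [nc] would
   merge the two components, and the result would meet [B] in more than two vertices. *)
have closed z z' : z \in D -> z' \in B -> connect (adjacent_in F) z z' -> z' \in D.
  rewrite !in_set => /andP[zB /andP[uz zv]] z'B czz'; rewrite z'B /=.
  have ncu w : w \in B -> connect (adjacent_in F) w z -> connect (adjacent_in F) u w -> False.
    move=> wB cwz cuw; have [e|e] := ends_u z zB (connect_trans cuw cwz).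
      by rewrite e ltxx in uz.
    by rewrite e ltxx in zv.
  have cz'z : connect (adjacent_in F) z' z by rewrite connect_adjacent_sym.
  have neq w : w \in B -> connect (adjacent_in F) u w -> theta w != theta z'.
    move=> wB cuw; apply/eqP => /(theta_inj _ _ wB z'B) wz'; apply: (ncu z' z'B cz'z).
    by rewrite -wz'.
  have tu := neq u uB (connect0 _ _); have tv := neq v vB cuv.
  rewrite !lt_neqAle tu [theta z' == _]eq_sym tv /=.
  rewrite !leNgt; apply/andP; split; apply/negP => h.
    apply: (ncu z' z'B cz'z); rewrite connect_adjacent_sym.
    by apply: (nc z' u z v) => //; split=> //; exact: Bs.
  apply: (ncu z zB (connect0 _ _)).
  by apply: (nc u z v z') => //; split=> //; exact: Bs.
have even_D : ~~ odd #|D|.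
  have eqv : {in D & &, equivalence_rel (connect (adjacent_in F))}.
    move=> x y z _ _ _; split; first exact: connect0.
    by move=> cxy; apply: (same_connect (connect_adjacent_sym F)).
  rewrite (card_uniform_partition _ (equivalence_partitionP eqv) (n := 2%N)).
    by rewrite oddM andbF.
  move=> Q /imsetP[x xD ->]; rewrite -(two x (subsetP DB _ xD)).
  apply: eq_card => z; rewrite [LHS]in_set [RHS]in_set.
  apply/andP/andP => -[zD cxz]; split=> //; first exact: (subsetP DB).
  exact: closed xD zD cxz.
case/negP: even_D; rewrite BE in DB uB vB; rewrite (odd_between DB).
have aD i : i \in J -> (a i \in D) = (theta u < theta (a i) < theta v).
  by move=> iJ; rewrite in_set BE mem_a_end_vertices iJ.
have bD i : i \in J -> (b i \in D) = (theta u < theta (b i) < theta v).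
  by move=> iJ; rewrite in_set BE mem_b_end_vertices iJ.
under eq_bigr => i iJ do rewrite aD // bD //.
have only (i0 : 'I_k) (f : 'I_k -> bool) : i0 \in J -> (forall i, f i = (i == i0)) ->
    \big[addb/false]_(i in J) f i.
  move=> i0J fE; rewrite (bigD1 i0) //= fE eqxx big1 // => i /andP[_ ii0].
  by rewrite fE; exact: negPf.
have a_codom i : (a i \in codom a) = true by exact: codom_f.
have b_codom i : (b i \in codom a) = false.
  by apply/codomP => -[j /eqP]; rewrite eq_sym (negPf (a_neq_b _ _)).
(* Strictly between [a i0] and [a i1] lie [b i0] and complete pairs, strictly between [b i0] and
   [b i1] complete pairs and [a i1]; exactly one pair is split, so [D] would be odd. *)
move: uB vB luv cuv' {uv cuv ends_u closed D DB aD bD}.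
case/end_verticesP => i0 i0J [->|->]; case/end_verticesP => i1 i1J [->|->];
  rewrite ?a_codom ?b_codom ?theta_aa ?theta_bb => // lt01 _.
  apply: (only i0) => // i; rewrite !theta_aa !theta_ab !theta_ba -val_eqE /=; lia.
apply: (only i1) => // i; rewrite !theta_bb !theta_ab !theta_ba -val_eqE /=; lia.
Qed.

End Alternation.

(** Degree 0 on [S] already keeps the edges of [m] away from the deleted vertices, so only the
    deleted edges [Y] have to be excluded explicitly. *)
Lemma perfect_matchingE (G : graph) (H : subgraph G) (Y : {set edge G})
    (S : {set vertex G}) (m : {set edge G}) :
    vset H = ~: S ->
    (forall x, (x \in eset H) = (x \notin Y) && [disjoint ends x & S]) ->
  perfect_matching H m = (m \subset ~: Y) && matches m S.
Proof.
move=> vH eH; apply/andP/andP => [[mH /forallP deg]|[mY /forallP deg]]; split.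
- by apply/subsetP => x /(subsetP mH); rewrite eH in_setC => /andP[].
- apply/forallP => v; have := deg v; rewrite vH in_setC /degree.
  case: (boolP (v \in S)) => //= vS _; rewrite cards_eq0; apply/eqP/setP => x.
  rewrite !inE; apply/negP => /andP[/(subsetP mH)]; rewrite eH => /andP[_ dis] vx.
  by rewrite (disjointFr dis vx) in vS.
- apply/subsetP => x xm; rewrite eH -in_setC (subsetP mY) //=.
  rewrite disjoint_subset; apply/subsetP => v vx; rewrite !inE; apply/negP => vS.
  have := deg v; rewrite vS cards_eq0 => /eqP/setP/(_ x).
  by rewrite !inE xm vx.
- apply/forallP => v; apply/implyP; rewrite vH in_setC => vS.
  by have := deg v; rewrite vS.
Qed.

(** * Expansion of matching sums by the edges of X that are used *)

Section Expansion.
Variables (R : numDomainType) (G : graph) (w : edge G -> R) (k : nat).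
Variables (a b : 'I_k -> vertex G) (e : 'I_k -> edge G).
Hypothesis ends_e : forall i, ends (e i) = [set a i; b i].
Hypothesis ends_disjoint : forall i i', i != i' -> [disjoint ends (e i) & ends (e i')].
Implicit Types (I J L : {set 'I_k}) (S : {set vertex G}).

Local Notation X := [set e i | i : 'I_k].
Local Notation ev := (end_vertices a b).
Local Notation N := (matching_sum w (~: X)).

Definition product_weight I := \prod_(i in I) w (e i).

Lemma mem_end_vertices I v : (v \in ev I) = [exists i in I, v \in ends (e i)].
Proof.
apply/end_verticesP/existsP => [[i iI vi]|[i /andP[iI]]].
  by exists i; rewrite iI ends_e !inE; case: vi => ->; rewrite eqxx ?orbT.
by rewrite ends_e !inE => /orP[]/eqP->; exists i => //; [left|right].
Qed.

Lemma ends_unique i j v : v \in ends (e i) -> v \in ends (e j) -> i = j.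
Proof.
move=> vi vj; apply/eqP; apply: contraT => /ends_disjoint dis.
by rewrite (disjointFr dis vi) in vj.
Qed.

Lemma e_inj : injective e.
Proof.
by move=> i j ij; apply: (@ends_unique i j (a i)); rewrite -?ij ends_e !inE eqxx.
Qed.

Lemma degree_matched (m : {set edge G}) I v : m \subset ~: X ->
  degree (m :|: e @: I) v = (degree m v + (v \in ev I))%N.
Proof.
move=> mX; rewrite /degree.
rewrite (_ : [set x in _ | _] = [set x in m | v \in ends x] :|:
    [set x in e @: I | v \in ends x]); last first.
  by apply/setP => x; rewrite !inE andb_orl.
rewrite cardsU (_ : _ :&: _ = set0) ?cards0 ?subn0; last first.
  apply/setP => x; rewrite !inE; apply/negP => /andP[/andP[xm _] /andP[xI _]].
  have := subsetP mX x xm; rewrite inE; case/negP.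
  by case/imsetP: xI => i _ ->; exact: imset_f.
congr (_ + _)%N; rewrite mem_end_vertices.
case: existsP => [[i /andP[iI vi]]|noi].
  apply/eqP/cards1P; exists (e i); apply/setP => x; rewrite !inE.
  apply/andP/eqP => [[/imsetP[j jI ->] vj]|->]; first by rewrite (ends_unique vi vj).
  by rewrite imset_f.
apply/eqP; rewrite cards_eq0; apply/eqP/setP => x; rewrite !inE; apply/negP.
by case/andP => /imsetP[i iI ->] vi; apply: noi; exists i; rewrite iI.
Qed.

Lemma matches_matched (m : {set edge G}) I S : m \subset ~: X ->
  matches (m :|: e @: I) S = [disjoint ev I & S] && matches m (S :|: ev I).
Proof.
move=> mX; apply/forallP/andP => [deg|[dis /forallP deg] v].
  have {}deg v : (degree m v + (v \in ev I))%N = (v \notin S).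
    by rewrite -degree_matched //; apply/eqP.
  split.
    rewrite disjoint_subset; apply/subsetP => v vI; rewrite !inE.
    by apply/negP => vS; have := deg v; rewrite vI vS addn1.
  apply/forallP => v; have := deg v; rewrite in_setU negb_or.
  case: (v \in ev I); last by rewrite addn0 andbT => ->.
  by case: (v \notin S); rewrite addn1 // => -[->].
rewrite degree_matched // (eqP (deg v)) in_setU negb_or.
have [vI|vI] := boolP (v \in ev I); last by rewrite andbT addn0.
by rewrite (disjointFr dis vI).
Qed.

Definition matched (m : {set edge G}) := [set i | e i \in m].

Lemma matchedK (m : {set edge G}) : (m :\: X) :|: e @: matched m = m.
Proof.
apply/setP => x; rewrite !inE; have [/imsetP[i _ ->]|nX] /= := boolP (x \in X).
  by rewrite (mem_imset _ _ e_inj) inE.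
suff /negbTE-> : x \notin e @: matched m by rewrite orbF.
by apply: contra nX => /imsetP[i _ ->]; rewrite imset_f.
Qed.

Lemma matched_setU (m : {set edge G}) I : m \subset ~: X ->
  (matched (m :|: e @: I) = I) * ((m :|: e @: I) :\: X = m).
Proof.
move=> mX; have mX' x : x \in m -> x \in X = false.
  by move/(subsetP mX); rewrite in_setC => /negbTE.
split; apply/setP => x; rewrite !inE.
  rewrite (mem_imset _ _ e_inj); case: (boolP (e x \in m)) => // /mX'.
  by rewrite imset_f.
have [/mX'-> //|_] := boolP (x \in m).
by apply/negP => /andP[/negP + /imsetP[i _ xe]]; apply; rewrite xe imset_f.
Qed.

(** Each matching splits into its part outside [X] and the set [I] of indices of its edges in [X].
    [L] indexes the edges of [X] that remain in the graph; the ends of the used ones act as further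
    deleted vertices of G - X. *)
Lemma matching_sum_expand L S :
  matching_sum w (~: (e @: ~: L)) S =
  \sum_(I : {set 'I_k} | (I \subset L) && [disjoint ev I & S])
     product_weight I * N (S :|: ev I).
Proof.
have mXX m : m :\: X \subset ~: X by rewrite setDE subsetIr.
rewrite [LHS](partition_big matched
  (fun I => (I \subset L) && [disjoint ev I & S])) /=; last first.
  move=> m /andP[mL mS]; apply/andP; split.
    apply/subsetP => i; rewrite inE => /(subsetP mL); rewrite in_setC.
    by apply: contraR => iL; rewrite imset_f // in_setC.
  by move: mS; rewrite -{1}[m]matchedK matches_matched // => /andP[].
apply: eq_bigr => I /andP[IL dis]; rewrite big_distrr /=.
rewrite (reindex_onto (fun m => m :|: e @: I) (fun m => m :\: X)) /=; last first.
  by move=> m /andP[_ /eqP <-]; exact: matchedK.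
apply: eq_big => [m|m /andP[_ /eqP mE]]; last first.
  have mX : m \subset ~: X by rewrite -mE.
  rewrite (bigID (mem X)) /=; congr (_ * _).
    rewrite (eq_bigl (mem (e @: I))) => [|x].
      by rewrite big_imset // => ? ? _ _; exact: e_inj.
    rewrite /= inE; have [xI|xI] /= := boolP (x \in e @: I).
      by rewrite orbT; case/imsetP: xI => i _ ->; rewrite imset_f.
    rewrite orbF; apply/negP => /andP[/(subsetP mX)].
    by rewrite in_setC => /negP.
  apply: eq_bigl => x; rewrite -[in RHS]mE !inE andbC.
  by [].
apply/idP/idP => [/andP[/andP[/andP[_ mS] _] /eqP mE]|/andP[mX mS]].
  have mX : m \subset ~: X by rewrite -mE.
  by rewrite mX /=; move: mS; rewrite matches_matched // => /andP[].
rewrite !(matched_setU _ mX) !eqxx !andbT matches_matched // dis mS !andbT.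
apply/subsetP => x; rewrite !inE => /orP[/(subsetP mX)|/imsetP[i iI ->]].
  by rewrite in_setC; apply: contra => /imsetP[i _ ->]; rewrite imset_f.
by rewrite (mem_imset _ _ e_inj) in_setC negbK (subsetP IL).
Qed.

End Expansion.

Section FaceEdges.
Variables (R : realDomainType) (G : graph) (w : edge G -> R) (k : nat).
Variables (a b : 'I_k -> vertex G) (e : 'I_k -> edge G) (theta : vertex G -> R).
Local Notation s := (flatten [seq [:: a i; b i] | i <- enum 'I_k]).
Hypothesis theta_sorted : sorted (fun u v => theta u < theta v) s.
Hypothesis noncrossing : forall F v0 v1 v2 v3,
  [/\ v0 \in s, v1 \in s, v2 \in s & v3 \in s] ->
  [/\ theta v0 < theta v1, theta v1 < theta v2 & theta v2 < theta v3] ->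
  connect (adjacent_in F) v0 v2 -> connect (adjacent_in F) v1 v3 ->
  connect (adjacent_in F) v0 v1.
Implicit Types (I J L : {set 'I_k}) (S : {set vertex G}).

Local Notation X := [set e i | i : 'I_k].
Local Notation ev := (end_vertices a b).
Local Notation N := (matching_sum w (~: X)).
Local Notation W := (product_weight w e).

(** The booleans select an [a] or a [b], so that both terms of the sum in [condensation_at] are
    instances. *)
Lemma end_verticesD I i j (c d : bool) : i \in I -> j \notin I ->
  let x (t : bool) l := if t then a l else b l in
  ev (j |: I) :\: [set x c j; x d i] = [set x (~~ c) j; x (~~ d) i] :|: ev (I :\ i).
Proof.
move=> iI jI x.
have memx t l J : (x t l \in ev J) = (l \in J).
  by case: t; rewrite ?(mem_a_end_vertices theta_sorted) ?(mem_b_end_vertices theta_sorted).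
have x_eq t t' l l' : (x t l == x t' l') = (t == t') && (l == l').
  case: t t' => [] [] /=; rewrite ?(inj_eq (a_inj theta_sorted)) ?(inj_eq (b_inj theta_sorted)) //.
    by apply: negbTE; exact: a_neq_b theta_sorted _ _.
  by rewrite eq_sym; apply: negbTE; exact: a_neq_b theta_sorted _ _.
have ij : i != j by apply: contraNneq jI => <-.
have key t l : (x t l \in ev (j |: I) :\: [set x c j; x d i]) =
    (x t l \in [set x (~~ c) j; x (~~ d) i] :|: ev (I :\ i)).
  rewrite in_setD in_set2 in_setU in_set2 !memx !x_eq in_setU1 in_setD1.
  have [->|lj] := eqVneq l j; first by rewrite (negPf jI) [j == i]eq_sym (negPf ij) /=; case: t c d => [] [] [].
  have [->|li] := eqVneq l i; first by rewrite iI; case: t c d {x memx x_eq} => [] [] [].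
  by rewrite !andbF.
apply/setP => v; have [/existsP[[t l] /eqP ->]|nx] :=
  boolP [exists tl : bool * 'I_k, v == x tl.1 tl.2]; first exact: key.
have vx t l : v == x t l = false.
  by apply: contraNF nx => vtl; apply/existsP; exists (t, l).
have vev J : v \in ev J = false.
  apply/negP => /end_verticesP[l _ [vl|vl]].
    by have := vx true l; rewrite vl eqxx.
  by have := vx false l; rewrite vl eqxx.
by rewrite in_setD in_set2 in_setU in_set2 !vev !vx andbF.
Qed.

Lemma end_verticesD1 I j : j \notin I -> ev (j |: I) :\: [set a j; b j] = ev I.
Proof.
move=> jI; apply/setP => v; rewrite in_setD in_set2.
apply/andP/idP => [[]|vI].
  rewrite negb_or => /andP[vaj vbj] /end_verticesP[i].
  rewrite in_setU1 => /orP[/eqP->|iI] vi; last by apply/end_verticesP; exists i.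
  by case: vi vaj vbj => ->; rewrite eqxx.
have /end_verticesP[i iI vi] := vI; split.
  apply/norP; split; apply: contraNneq jI => vj; move: vI; rewrite vj.
    by rewrite (mem_a_end_vertices theta_sorted).
  by rewrite (mem_b_end_vertices theta_sorted).
by apply/end_verticesP; exists i; rewrite // inE iI orbT.
Qed.

(** This is [condensation] based at [a j], coloured by membership in [codom a]. The partner [b j] of
    [a j] gives the first product; the partners [b i] and [a i] give the two terms of the sum, with
    opposite signs. *)
Lemma condensation_at I j : j \notin I ->
  N set0 * N (ev (j |: I)) =
  N [set a j; b j] * N (ev I) +
  \sum_(i in I) (N [set a j; b i] * N ([set b j; a i] :|: ev (I :\ i)) -
                 N [set a j; a i] * N ([set b j; b i] :|: ev (I :\ i))).
Proof.
move=> jI; have aj : a j \in ev (j |: I).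
  by rewrite (mem_a_end_vertices theta_sorted) setU11.
rewrite (condensation w (~: X) aj (c := fun v => v \in codom a)); last first.
  by move=> F; apply: (linked_alternate theta_sorted (@noncrossing F)).
have ca i : (a i \in codom a) = true by exact: codom_f.
have cb i : (b i \in codom a) = false.
  by apply/codomP => -[l /eqP]; rewrite eq_sym (negPf (a_neq_b theta_sorted _ _)).
have evU : ev (j |: I) :\ a j = b j |: ev I.
  apply/setP => v; rewrite -(end_verticesD1 jI) in_setD1 in_setU1 in_setD in_set2.
  have [->|] := eqVneq v (b j); last by rewrite orbF.
  by rewrite eq_sym (a_neq_b theta_sorted) (mem_b_end_vertices theta_sorted) setU11.
rewrite evU big_setU1 /=; last by rewrite (mem_b_end_vertices theta_sorted).
rewrite ca cb /= mul1r end_verticesD1 //; congr (_ + _).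
rewrite (big_end_vertices theta_sorted); apply: eq_bigr => i iI.
rewrite ca cb /= expr1 mul1r mulN1r addrC.
by rewrite (end_verticesD true false iI jI) (end_verticesD true true iI jI).
Qed.

Hypothesis ends_e : forall i, ends (e i) = [set a i; b i].
Hypothesis ends_disjoint : forall i i', i != i' -> [disjoint ends (e i) & ends (e i')].

Lemma disjoint_set0 (A : {set vertex G}) :
  [disjoint set0 & A] * [disjoint A & set0].
Proof. by rewrite -!setI_eq0 set0I setI0 eqxx. Qed.

Lemma product_weightU1 i I : i \notin I -> W (i |: I) = w (e i) * W I.
Proof. exact: big_setU1. Qed.

Lemma reindex_setU1 i (P : pred {set 'I_k}) (F : {set 'I_k} -> R) :
  \sum_(I | P I && (i \in I)) F I =
  \sum_(I | P (i |: I) && (i \notin I)) F (i |: I).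
Proof.
rewrite (reindex_onto (fun I => i |: I) (fun I => I :\ i)) /=; last first.
  by move=> I /andP[_ iI]; exact: setD1K.
apply: eq_bigl => I; rewrite setU11 andbT; congr (_ && _).
by apply/eqP/idP => [<-|iI]; [rewrite setD11 | exact: setU1K].
Qed.

Lemma matching_sum_setD1 j S : matching_sum w (~: (X :\ e j)) S =
  N S + (if [disjoint [set a j; b j] & S] then w (e j) * N (S :|: [set a j; b j]) else 0).
Proof.
have -> : X :\ e j = e @: ~: [set j].
  apply/setP => x; rewrite !inE; apply/andP/imsetP => [[xj /imsetP[i _ xi]]|[i]].
    by exists i => //; rewrite !inE; apply: contraNneq xj => ij; rewrite xi ij.
  by rewrite !inE => ij ->; rewrite (inj_eq (e_inj ends_e ends_disjoint)) ij imset_f.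
rewrite (matching_sum_expand w ends_e ends_disjoint) big_mkcond.
have ev0 : ev set0 = set0 by rewrite /end_vertices !imset0 setU0.
have ev1 : ev [set j] = [set a j; b j] by rewrite /end_vertices !imset_set1.
rewrite (bigD1 set0) //= sub0set ev0 disjoint_set0 /= setU0.
rewrite (bigD1 [set j]) /=; last by apply/set0Pn; exists j; rewrite inE.
rewrite subxx ev1 /= big1 ?addr0 => [|I /andP[I0 Ij]]; last first.
  by rewrite subset1 (negPf I0) (negPf Ij).
by rewrite /product_weight big_set0 big_set1 mul1r.
Qed.

Lemma matching_sum_setC1 j : matching_sum w (~: [set e j]) set0 =
  \sum_(I : {set 'I_k} | j \notin I) W I * N (ev I).
Proof.
have -> : [set e j] = e @: ~: ~: [set j] by rewrite setCK imset_set1.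
rewrite (matching_sum_expand w ends_e ends_disjoint).
apply: eq_big => I; last by rewrite set0U.
by rewrite disjoint_set0 andbT subsetC sub1set in_setC.
Qed.

Lemma matching_sum_setT S : matching_sum w setT S =
  \sum_(I : {set 'I_k} | [disjoint ev I & S]) W I * N (S :|: ev I).
Proof.
have -> : [set: edge G] = ~: (e @: ~: setT) by rewrite setCT imset0 setC0.
rewrite (matching_sum_expand w ends_e ends_disjoint).
by apply: eq_bigl => I; rewrite subsetT.
Qed.

(** In the expansion of the left-hand side, the sets without [j] match the matchings of the second
    factor on the right that avoid [e j]. The sets with [j], stripped of it, are compared
    coefficient by coefficient through [condensation_at]. *)
Lemma face_condensation j :
  matching_sum w setT set0 * N set0 =
  matching_sum w (~: [set e j]) set0 * matching_sum w (~: (X :\ e j)) set0 +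
  w (e j) * \sum_(i < k | i != j) w (e i) *
    (matching_sum w setT [set b j; a i] * N [set a j; b i] -
     matching_sum w setT [set b j; b i] * N [set a j; a i]).
Proof.
rewrite matching_sum_setC1 matching_sum_setD1 disjoint_set0 set0U matching_sum_setT.
have dis i x y : (forall I, (x \in ev I) = (j \in I)) ->
    (forall I, (y \in ev I) = (i \in I)) ->
    forall I, [disjoint ev I & [set x; y]] = (j \notin I) && (i \notin I).
  move=> xj yi I; rewrite disjoint_sym disjoints_subset subUset !sub1set !in_setC.
  by rewrite xj yi.
have mema := mem_a_end_vertices theta_sorted.
have memb := mem_b_end_vertices theta_sorted.
pose t I i := N [set a j; b i] * N ([set b j; a i] :|: ev (I :\ i)) -
              N [set a j; a i] * N ([set b j; b i] :|: ev (I :\ i)).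
(* A deleted end of [e i] forces [i \notin I] in the expansion; the factor [w (e i)] is absorbed by
   passing to [i |: I], which gives the coefficients of [condensation_at]. *)
have term i : i != j -> w (e i) *
    (matching_sum w setT [set b j; a i] * N [set a j; b i] -
     matching_sum w setT [set b j; b i] * N [set a j; a i]) =
    \sum_(I : {set 'I_k} | (j \notin I) && (i \in I)) W I * t I i.
  move=> ij; rewrite !matching_sum_setT (reindex_setU1 i (fun I => j \notin I)).
  rewrite (eq_bigl _ _ (dis i _ _ (memb j) (mema i))).
  rewrite (eq_bigl _ _ (dis i _ _ (memb j) (memb i))).
  rewrite mulrBr !mulr_suml !mulr_sumr -sumrB; apply: eq_big => I.
    by rewrite in_setU1 negb_or [j == i]eq_sym ij.
  case/andP => _ iI; rewrite product_weightU1 // /t setU1K //; ring.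
rewrite (eq_bigr _ term) (exchange_big_dep (fun I => j \notin I)) /=; last first.
  by move=> i I _ /andP[].
rewrite (eq_bigl predT) => [|I]; last by rewrite disjoint_set0.
rewrite (eq_bigr (fun I => W I * N (ev I))) => [|I _]; last by rewrite set0U.
rewrite (bigID (fun I : {set 'I_k} => j \in I)) /= (reindex_setU1 j predT) /=.
rewrite mulrDl mulrDr addrC -addrA; congr (_ + _).
rewrite [LHS]mulr_suml [X in X + _]mulr_suml [X in _ + X]mulr_sumr -big_split /=.
apply: eq_bigr => I jI.
rewrite product_weightU1 // -mulrA [N _ * N set0]mulrC condensation_at //.
have -> : \sum_(i < k | [&& i != j, j \notin I & i \in I]) W I * t I i =
    W I * \sum_(i in I) t I i.
  rewrite mulr_sumr; apply: eq_bigl => i; rewrite jI /=.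
  by case: eqVneq => // ->; rewrite (negPf jI).
by rewrite -[\sum_(i in I) (_ - _)]/(\sum_(i in I) t I i); ring.
Qed.

End FaceEdges.

(** * Crossings of polygonal lines *)

Section Crossing.
Variable R : realFieldType.
Implicit Types x y z u v : R * R.

Definition orient x y z : R :=
  (y.1 - x.1) * (z.2 - x.2) - (y.2 - x.2) * (z.1 - x.1).

Definition ccw x y z := 0 < orient x y z.

(** In general position: each segment separates the ends of the other, that is, they intersect. *)
Definition cross x y u v :=
  (ccw x y u (+) ccw x y v) && (ccw u v x (+) ccw u v y).

Definition in_triangle x y z u :=
  [&& ccw x y u == ccw x y z, ccw y z u == ccw x y z & ccw z x u == ccw x y z].

Lemma crossC x y u v : cross x y u v = cross u v x y.
Proof. exact: andbC. Qed.

Lemma orientC x y z : orient y x z = - orient x y z.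
Proof. by rewrite /orient; ring. Qed.

Lemma orientA x y z : orient y z x = orient x y z.
Proof. by rewrite /orient; ring. Qed.

Lemma ccw_rot x y z : ccw y z x = ccw x y z.
Proof. by rewrite /ccw orientA. Qed.

Lemma ccw_swap x y z : orient x y z != 0 -> ccw y x z = ~~ ccw x y z.
Proof. by move=> nz; rewrite /ccw orientC oppr_gt0 -leNgt le_eqVlt (negPf nz). Qed.

Lemma ccw_degenerate x u : ccw x x u = false.
Proof. by rewrite /ccw /orient !subrr !mul0r subrr ltxx. Qed.

Lemma cross_degenerate x u v : cross x x u v = false.
Proof. by rewrite /cross !ccw_degenerate. Qed.

(* Summands with alternating signs in a vanishing sum cannot all have the same
   sign. *)
Definition sign3 (a b c : bool) := ~~ ((a == ~~ b) && (a == c)).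
Definition sign4 (a b c d : bool) := ~~ [&& a == ~~ b, a == c & a == ~~ d].

Lemma sign4P (a b c d : R) : a - b + c - d = 0 ->
  a != 0 -> b != 0 -> c != 0 -> d != 0 -> sign4 (0 < a) (0 < b) (0 < c) (0 < d).
Proof.
rewrite /sign4; case: (ltrgt0P a) => // ?; case: (ltrgt0P b) => // ?;
  by case: (ltrgt0P c) => // ?; case: (ltrgt0P d) => //= ?; lra.
Qed.

Lemma sign3P (a a' b b' c c' : R) : a * a' - b * b' + c * c' = 0 ->
    a != 0 -> a' != 0 -> b != 0 -> b' != 0 -> c != 0 -> c' != 0 ->
  sign3 ((0 < a) == (0 < a')) ((0 < b) == (0 < b')) ((0 < c) == (0 < c')).
Proof.
have sgM (p q : R) : p != 0 -> q != 0 ->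
    (((0 < p) == (0 < q)) = (0 < p * q)) * (p * q != 0).
  move=> p0 q0; rewrite mulf_neq0 //; split=> //.
  case: (ltrgt0P p) p0 => // hp _; case: (ltrgt0P q) q0 => // hq _.
  - by rewrite mulr_gt0.
  - by rewrite ltNge nmulr_lle0 ?ltW.
  - by rewrite ltNge pmulr_lle0 ?ltW.
  - by rewrite nmulr_rgt0.
move=> E a0 a'0 b0 b'0 c0 c'0; rewrite !sgM // /sign3.
move: E (sgM _ _ a0 a'0) (sgM _ _ b0 b'0) (sgM _ _ c0 c'0).
move: (a * _) => p; move: (b * _) => q; move: (c * _) => r E [_ +] [_ +] [_ +].
by case: (ltrgt0P p) => // ?; case: (ltrgt0P q) => // ?;
   case: (ltrgt0P r) => //= ?; lra.
Qed.

Definition general_position x y z u v :=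
  [&& orient x y z != 0, orient x y u != 0, orient x y v != 0,
      orient x z u != 0 & orient x z v != 0] &&
  [&& orient x u v != 0, orient y z u != 0, orient y z v != 0,
      orient y u v != 0 & orient z u v != 0].

(* The five four-point identities and the five Grassmann-Pluecker relations:
   they determine the possible orientations of five points. *)
Lemma five_point_orientations x y z u v : general_position x y z u v ->
  [&& sign4 (ccw x y z) (ccw x y u) (ccw x z u) (ccw y z u),
      sign4 (ccw x y z) (ccw x y v) (ccw x z v) (ccw y z v),
      sign4 (ccw x y u) (ccw x y v) (ccw x u v) (ccw y u v),
      sign4 (ccw x z u) (ccw x z v) (ccw x u v) (ccw z u v)
    & sign4 (ccw y z u) (ccw y z v) (ccw y u v) (ccw z u v)] &&
  [&& sign3 (ccw x y z == ccw x u v) (ccw x y u == ccw x z v)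
        (ccw x y v == ccw x z u),
      sign3 (ccw x y z == ccw y u v) (ccw x y u == ccw y z v)
        (ccw x y v == ccw y z u),
      sign3 (ccw x y z == ccw z u v) (ccw x z u == ccw y z v)
        (ccw x z v == ccw y z u),
      sign3 (ccw x y u == ccw z u v) (ccw x z u == ccw y u v)
        (ccw x u v == ccw y z u)
    & sign3 (ccw x y v == ccw z u v) (ccw x z v == ccw y u v)
        (ccw x u v == ccw y z v)].
Proof.
case/andP=> /and5P[xyz xyu xyv xzu xzv] /and5P[xuv yzu yzv yuv zuv].
apply/andP; split; apply/and5P; split;
  by (apply: sign4P || apply: sign3P) => //; rewrite /orient; ring.
Qed.

(** The discrete Jordan theorem for a triangle. It is verified on all sign patterns of the ten
    orientations; those where it would fail contradict [five_point_orientations]. *)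
Lemma triangle_crossings x y z u v : general_position x y z u v ->
  cross x y u v (+) cross y z u v (+) cross x z u v =
  in_triangle x y z u (+) in_triangle x y z v.
Proof.
move=> gp; have := five_point_orientations gp.
case/andP: gp => /and5P[xyz xyu xyv xzu xzv] /and5P[xuv yzu yzv yuv zuv].
rewrite /cross /in_triangle (ccw_swap xzu) (ccw_swap xzv) !(ccw_rot _ u v).
by do 10![case: (ccw _ _ _)].
Qed.

(** The number is 1, 3 or 5 according to whether the convex hull of the points has 3, 4 or 5
    corners; the proof enumerates sign patterns instead. *)
Lemma odd_straight_K5_crossings x y z u v : general_position x y z u v ->
  cross x y z u (+) cross x z y u (+) cross x u y z (+)
  cross x y z v (+) cross x z y v (+) cross x v y z (+)
  cross x y u v (+) cross x u y v (+) cross x v y u (+)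
  cross x z u v (+) cross x u z v (+) cross x v z u (+)
  cross y z u v (+) cross y u z v (+) cross y v z u.
Proof.
move=> gp; have := five_point_orientations gp.
case/andP: gp => /and5P[xyz xyu xyv xzu xzv] /and5P[xuv yzu yzv yuv zuv].
have swap p q r : orient p q r != 0 -> ccw p r q = ~~ ccw p q r.
  by move=> /ccw_swap <-; exact: ccw_rot.
rewrite /cross !(ccw_rot x) !(ccw_rot y z) !(ccw_rot y u) !(ccw_rot z u).
rewrite !(swap _ _ _ xyz) !(swap _ _ _ xyu) !(swap _ _ _ xyv)
  !(swap _ _ _ xzu) !(swap _ _ _ xzv) !(swap _ _ _ xuv) !(swap _ _ _ yzu)
  !(swap _ _ _ yzv) !(swap _ _ _ yuv) !(swap _ _ _ zuv).
by do 10![case: (ccw _ _ _)].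
Qed.

End Crossing.

(** * Invariance of the crossing parity under straightening *)

Section PolygonCrossing.
Variables (R : realFieldType) (T : eqType) (z : T -> R * R).
Implicit Types (A B C D : seq (T * T)) (i j k l : T) (q : seq T).

Definition crossings A B : bool :=
  \big[addb/false]_(s <- A) \big[addb/false]_(t <- B)
    cross (z s.1) (z s.2) (z t.1) (z t.2).

Definition polyline i q : seq (T * T) := pairmap pair i q.

(* Mod 2 cycles: no function has a boundary term. *)
Definition mod2_cycle D := forall g : T -> bool,
  \big[addb/false]_(t <- D) (g t.1 (+) g t.2) = false.

Lemma crossingsC A B : crossings A B = crossings B A.
Proof.
rewrite /crossings exchange_big; apply: eq_bigr => s _; apply: eq_bigr => t _.
exact: crossC.
Qed.

Lemma crossings_catl A B C :
  crossings (A ++ B) C = crossings A C (+) crossings B C.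
Proof. exact: big_cat. Qed.

Lemma crossings_catr A B C :
  crossings A (B ++ C) = crossings A B (+) crossings A C.
Proof. by rewrite !(crossingsC A) crossings_catl. Qed.

Lemma crossings_segments i j k l :
  crossings (polyline i [:: j]) (polyline k [:: l]) = cross (z i) (z j) (z k) (z l).
Proof. by rewrite /crossings /= !big_cons !big_nil /= !addbF. Qed.

Lemma polyline_boundary i q (g : T -> bool) :
  \big[addb/false]_(t <- polyline i q) (g t.1 (+) g t.2) = g i (+) g (last i q).
Proof.
elim: q i => [|j q IH] i /=; first by rewrite big_nil addbb.
by rewrite big_cons IH /= addbA addbK.
Qed.

Lemma mod2_cycle_triangle i j k q1 q2 q3 :
    last i q1 = j -> last j q2 = k -> last i q3 = k ->
  mod2_cycle (polyline i q1 ++ polyline j q2 ++ polyline i q3).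
Proof.
move=> e1 e2 e3 g; rewrite !big_cat /= !polyline_boundary e1 e2 e3.
by case: (g i) (g j) (g k) => [] [] [].
Qed.

Lemma mem_polyline i q t : t \in polyline i q ->
  (t.1 \in i :: q) && (t.2 \in i :: q).
Proof.
elim: q i => // j q IH i; rewrite inE => /predU1P[->|/IH /andP[h1 h2]].
  by rewrite /= !inE !eqxx !orbT.
by rewrite !(in_cons i) h1 h2 !orbT.
Qed.

Lemma polyline_neq i q t : uniq (i :: q) -> t \in polyline i q -> t.1 != t.2.
Proof.
elim: q i => // j q IH i /andP[niq uq]; rewrite inE => /predU1P[->|/IH->//].
by move: niq; rewrite inE negb_or => /andP[].
Qed.

Variable U : seq T.
Hypothesis generic : {in U & &, forall i j k, uniq [:: i; j; k] ->
  orient (z i) (z j) (z k) != 0}.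

Lemma general_positionP i j k l m : all (mem U) [:: i; j; k; l; m] ->
  uniq [:: i; j; k; l; m] -> general_position (z i) (z j) (z k) (z l) (z m).
Proof.
case/and5P=> iU jU kU lU /andP[mU _]; rewrite /= !inE !negb_or.
case/and5P=> /and4P[ij ik il im] /and3P[jk jl jm] /andP[kl km] lm _.
by apply/andP; split; apply/and5P; split; apply: generic => //=;
  rewrite !inE !negb_or andbT; apply/andP; split=> //; apply/andP; split.
Qed.

(** By [triangle_crossings], passing from [i j k] to the chord [i k] changes the count with a
    segment by the sum of [in_triangle] over its two ends, and such sums vanish on a cycle. *)
Lemma crossings_triangle i j k D :
    mod2_cycle D -> (forall t, t \in D -> uniq [:: i; j; k; t.1; t.2] /\
      all (mem U) [:: i; j; k; t.1; t.2]) ->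
  crossings [:: (i, k)] D = crossings [:: (i, j); (j, k)] D.
Proof.
have eq_addb (b c : bool) : b (+) c = false -> b = c by case: b c => [] [].
move=> cD genD; apply: eq_addb.
rewrite /crossings !big_cons !big_nil /= !addbF -!big_split /=.
rewrite -[RHS](cD (fun t => in_triangle (z i) (z j) (z k) (z t))).
apply: eq_big_seq => t /genD[ut Ut]; rewrite addbC.
by apply: triangle_crossings; apply: general_positionP.
Qed.

(** The tail is straightened by induction; then the triangle on [i], [j] and the last point is
    collapsed. *)
Lemma crossings_polyline i q D : uniq (i :: q) -> {subset i :: q <= U} ->
    mod2_cycle D ->
    (forall t, t \in D -> [/\ t.1 \in U, t.2 \in U, t.1 != t.2,
       t.1 \notin i :: q & t.2 \notin i :: q]) ->
  crossings (polyline i q) D = crossings (polyline i [:: last i q]) D.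
Proof.
move=> + + cD; elim: q i => [|j [|k q] IH] i uiq sU genD.
- rewrite /crossings /= big_cons !big_nil addbF big1 // => t _.
  exact: cross_degenerate.
- by [].
rewrite -[polyline i _]/([:: (i, j)] ++ polyline j (k :: q)) crossings_catl.
have /andP[niq uq] := uiq.
rewrite IH //; first last.
- move=> t /genD[? ? ?]; rewrite !(in_cons i) !negb_or => /andP[_ ?] /andP[_ ?].
  by split.
- by move=> x xq; apply: sU; rewrite inE xq orbT.
rewrite -[last i _]/(last j (k :: q)).
have := mem_last k q; rewrite -[last k q]/(last j (k :: q)).
move: (last _ _) => l lq; rewrite (@crossings_triangle i j l) // => [|t /genD].
  by rewrite -crossings_catl.
case=> t1U t2U t12 nt1 nt2.
have nt x y : x \notin [:: i, j, k & q] -> y \in [:: i, j, k & q] -> y != x.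
  by move=> xn yq; apply: contraNneq xn => <-.
have lq' : l \in [:: i, j, k & q] by rewrite !(in_cons _ (_ :: _)) lq !orbT.
have iq : i \in [:: i, j, k & q] by rewrite mem_head.
have jq : j \in [:: i, j, k & q] by rewrite !in_cons eqxx orbT.
split; last first.
  apply/allP=> x; rewrite !inE.
  by case/or4P=> [||| /orP[]] /eqP-> //; apply: sU.
rewrite /= !inE !negb_or t12 !(nt t.1) // !(nt t.2) // !andbT /=.
have -> : i != j by move: niq; rewrite inE negb_or => /andP[].
have -> : i != l by apply: contraNneq niq => ->; rewrite in_cons lq orbT.
by move: uq => /= /andP[+ _]; apply: contraNneq => ->.
Qed.


Section CompleteGraph.
Variables (v : nat -> T) (q : nat -> nat -> seq T).

(** Covers an edge before and after straightening: in both states it uses only points of the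
    original line, so the disjointness assumed for [q] serves at every stage. *)
Definition edge_path (m n : nat) r :=
  [/\ last (v m) r = v n, uniq (v m :: r) & {subset v m :: r <= v m :: q m n}].

Hypothesis v_neq : forall m n, (m < n < 5)%N -> v m != v n.
Hypothesis q_path : forall m n, (m < n < 5)%N -> edge_path m n (q m n).
Hypothesis q_U : forall m n, (m < n < 5)%N -> {subset v m :: q m n <= U}.
Hypothesis q_disjoint : forall m n m' n', (m < n < 5)%N -> (m' < n' < 5)%N ->
  uniq [:: m; n; m'; n'] -> forall t, t \in v m :: q m n ->
  t \notin v m' :: q m' n'.
Hypothesis q_crossings : forall m n m' n', (m < n < 5)%N -> (m' < n' < 5)%N ->
  uniq [:: m; n; m'; n'] ->
  crossings (polyline (v m) (q m n)) (polyline (v m') (q m' n')) = false.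

Lemma edge_path_straight m n : (m < n < 5)%N -> edge_path m n [:: v n].
Proof.
move=> mn; have [e u _] := q_path mn; have vn : v n \in v m :: q m n.
  by rewrite -e mem_last.
split=> //=; first by rewrite inE andbT v_neq.
by move=> x; rewrite !inE => /orP[/eqP-> | /eqP->//]; rewrite eqxx.
Qed.

Lemma straighten_edge (m n i j k : nat) (r1 r2 r3 : seq T) : (m < n < 5)%N ->
    (i < j < 5)%N -> (j < k < 5)%N -> uniq [:: m; n; i; j; k] ->
    edge_path i j r1 -> edge_path j k r2 -> edge_path i k r3 ->
  crossings (polyline (v m) (q m n))
    (polyline (v i) r1 ++ polyline (v j) r2 ++ polyline (v i) r3) =
  crossings (polyline (v m) [:: v n])
    (polyline (v i) r1 ++ polyline (v j) r2 ++ polyline (v i) r3).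
Proof.
move=> mn ij jk umn [e1 u1 s1] [e2 u2 s2] [e3 u3 s3].
have [em um sm] := q_path mn.
have key a b (r : seq T) : (a < b < 5)%N -> uniq [:: m; n; a; b] ->
    uniq (v a :: r) -> {subset v a :: r <= v a :: q a b} ->
    forall t, t \in polyline (v a) r ->
    [/\ t.1 \in U, t.2 \in U, t.1 != t.2,
       t.1 \notin v m :: q m n & t.2 \notin v m :: q m n].
  move=> ab umnab ur sr t tr; have /andP[/sr t1 /sr t2] := mem_polyline tr.
  split; rewrite ?(q_U ab) ?(polyline_neq ur tr) //.
    by apply: contraL t1; apply: q_disjoint.
  by apply: contraL t2; apply: q_disjoint.
have ik : (i < k < 5)%N by case/andP: ij jk => ij _ /andP[/(ltn_trans ij)->].
rewrite crossings_polyline ?em //; first exact: q_U.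
  exact: mod2_cycle_triangle e1 e2 e3.
move: umn; rewrite /= !inE !negb_or.
case/and5P=> /and4P[n1 n2 n3 n4] /and3P[n5 n6 n7] /andP[n8 n9] n10 _.
move=> t; rewrite !mem_cat => /or3P[] tr;
  [apply: (key _ _ _ ij _ u1 s1 _ tr) | apply: (key _ _ _ jk _ u2 s2 _ tr)
   | apply: (key _ _ _ ik _ u3 s3 _ tr)];
  by rewrite /= !inE !negb_or ?n1 ?n2 ?n3 ?n4 ?n5 ?n6 ?n7 ?n8 ?n9 ?n10.
Qed.

(* The parity of the number of crossings between independent edges does not
   change when the edges are straightened one by one: the three edges that are
   independent of a given edge of K5 form a triangle. *)
Lemma no_planar_polygonal_K5 : False.
Proof.
pose P (m n : nat) := polyline (v m) (q m n).
pose S (m n : nat) := polyline (v m) [:: v n].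
have st01 := @straighten_edge 0%N 1%N 2%N 3%N 4%N _ _ _ isT isT isT isT.
have st02 := @straighten_edge 0%N 2%N 1%N 3%N 4%N _ _ _ isT isT isT isT.
have st03 := @straighten_edge 0%N 3%N 1%N 2%N 4%N _ _ _ isT isT isT isT.
have st04 := @straighten_edge 0%N 4%N 1%N 2%N 3%N _ _ _ isT isT isT isT.
have st12 := @straighten_edge 1%N 2%N 0%N 3%N 4%N _ _ _ isT isT isT isT.
have st13 := @straighten_edge 1%N 3%N 0%N 2%N 4%N _ _ _ isT isT isT isT.
have st14 := @straighten_edge 1%N 4%N 0%N 2%N 3%N _ _ _ isT isT isT isT.
have st23 := @straighten_edge 2%N 3%N 0%N 1%N 4%N _ _ _ isT isT isT isT.
have st24 := @straighten_edge 2%N 4%N 0%N 1%N 3%N _ _ _ isT isT isT isT.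
have st34 := @straighten_edge 3%N 4%N 0%N 1%N 2%N _ _ _ isT isT isT isT.
have p m n mn := @q_path m n mn; have s m n mn := @edge_path_straight m n mn.
(* The edges are straightened in lexicographic order: [s] supplies those already straight, [p] those
   still polygonal. *)
have {st01} := st01 _ _ _ (p 2 3 isT)%N (p 3 4 isT)%N (p 2 4 isT)%N.
have {st02} := st02 _ _ _ (p 1 3 isT)%N (p 3 4 isT)%N (p 1 4 isT)%N.
have {st03} := st03 _ _ _ (p 1 2 isT)%N (p 2 4 isT)%N (p 1 4 isT)%N.
have {st04} := st04 _ _ _ (p 1 2 isT)%N (p 2 3 isT)%N (p 1 3 isT)%N.
have {st12} := st12 _ _ _ (s 0 3 isT)%N (p 3 4 isT)%N (s 0 4 isT)%N.
have {st13} := st13 _ _ _ (s 0 2 isT)%N (p 2 4 isT)%N (s 0 4 isT)%N.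
have {st14} := st14 _ _ _ (s 0 2 isT)%N (p 2 3 isT)%N (s 0 3 isT)%N.
have {st23} := st23 _ _ _ (s 0 1 isT)%N (s 1 4 isT)%N (s 0 4 isT)%N.
have {st24} := st24 _ _ _ (s 0 1 isT)%N (s 1 3 isT)%N (s 0 3 isT)%N.
have {st34} := st34 _ _ _ (s 0 1 isT)%N (s 1 2 isT)%N (s 0 2 isT)%N.
rewrite !crossings_catr !q_crossings // -![polyline _ [:: _]]/(S _ _).
rewrite -!/(P _ _) !(crossingsC (S _ _) (P _ _)) !addFb.
have eq_addb (b1 b2 b3 : bool) : false = b1 (+) (b2 (+) b3) -> b3 = b1 (+) b2.
  by case: b1 b2 b3 => [] [] [].
(* Each of the fifteen independent pairs has a mixed parity, with one edge straight and the other
   not. Four equations eliminate one each; the other eleven become free booleans. *)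
move=> e34 e24 e23 e14 e13 e12 /eq_addb e04 /eq_addb e03 /eq_addb e02 /eq_addb e01.
move: e34 e24 e23 e14 e13 e12; rewrite e01 e02 e03 e04 {e01 e02 e03 e04}.
do 11![move: (crossings (P _ _) (S _ _)) => ?].
rewrite !crossings_segments => e34 e24 e23 e14 e13 e12.
have vU m : (m < 5)%N -> v m \in U.
  case: m => [|m] m5; first by apply: (q_U (_ : (0 < 1 < 5)%N)); rewrite ?mem_head.
  by have [<- _ _] := p 0%N m.+1 m5; apply: (@q_U 0%N m.+1 m5 _ (mem_last _ _)).
have gp : general_position (z (v 0)) (z (v 1)) (z (v 2)) (z (v 3)) (z (v 4)).
  by apply: general_positionP; rewrite /= ?vU // !inE !negb_or !v_neq.
have := odd_straight_K5_crossings gp.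
move: e34 e24 e23 e14 e13 e12.
rewrite !(crossC _ _ (z (v 0))) !(crossC _ _ (z (v 1)) (z (v 2)))
  !(crossC _ _ (z (v 1)) (z (v 3))) !(crossC _ _ (z (v 1)) (z (v 4))).
move=> e34 e24 e23 e14 e13 e12.
(* Groups the straight crossings as they occur in the six equations. Every mixed parity then occurs
   twice, so the total is even. *)
rewrite (ACl ((7*(13*10)) * (4*(14*11)) * (1*(15*12)) * (5*8) * (2*9) * (3*6)))%AC /=.
have {}eq_addb (b1 b2 b3 c : bool) : c = b1 (+) (b2 (+) b3) -> b1 (+) b3 = b2 (+) c.
  by case: b1 b2 b3 c => [] [] [] [].
rewrite -e34 -e24 -e23 (eq_addb _ _ _ _ e14) (eq_addb _ _ _ _ e13) (eq_addb _ _ _ _ e12).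
clear; by do 11![match goal with b : bool |- _ => case: b end].
Qed.

End CompleteGraph.
End PolygonCrossing.

(** * Perturbation to general position *)

Section Perturbation.
Variable R : realFieldType.

(** Among the numbers [d / n.+1] there are more candidates than the product of the polynomials has
    roots. *)
Lemma exists_small_nonroot (ps : seq {poly R}) (d : R) : 0 < d ->
  (forall p, p \in ps -> p != 0) ->
  exists s, [/\ 0 < s, s <= d & forall p, p \in ps -> p.[s] != 0].
Proof.
move=> d0 nz; pose q := \prod_(p <- ps) p.
have q0 : q != 0 by rewrite prodf_seq_neq0; apply/allP => p /nz.
pose c n : R := d / n.+1%:R.
have c_inj : injective c.
  move=> m n /(mulfI (lt0r_neq0 d0))/invr_inj/eqP.
  by rewrite eqr_nat => /eqP[].
have : ~~ all (root q) [seq c n | n <- iota 0 (size q)].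
  apply/negP => /(max_poly_roots q0).
  by rewrite map_inj_uniq // iota_uniq size_map size_iota ltnn => /(_ isT).
case/allPn => s /mapP[n _ ->] nroot; exists (c n); split.
- by rewrite divr_gt0 // ltr0n.
- by rewrite ler_pdivrMr ?ltr0n // ler_peMr ?ler1n // ltW.
- move=> p pps; apply: contraNneq nroot => pc; rewrite /root horner_prod.
  by rewrite (big_rem p) //= pc mul0r.
Qed.

Lemma cross_meet (x y u v : R * R) : cross x y u v -> exists a b,
  [/\ 0 <= a <= 1, 0 <= b <= 1,
      x.1 + a * (y.1 - x.1) = u.1 + b * (v.1 - u.1)
    & x.2 + a * (y.2 - x.2) = u.2 + b * (v.2 - u.2)].
Proof.
case/andP=> xy uv.
have sep (p q : R) : (0 < p) (+) (0 < q) -> p != q /\ 0 <= p / (p - q) <= 1.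
  move=> pq; have pnq : p != q by apply: contraTneq pq => ->; rewrite addbb.
  split=> //; case/orP: (lt_total pnq) => lt.
    have d0 : 0 < q - p by rewrite subr_gt0.
    rewrite -opprB invrN mulrN -mulNr ler_pdivlMr // ler_pdivrMr //.
    by move: pq; case: (ltrgt0P p) => ?; case: (ltrgt0P q) => // ? _; lra.
  have d0 : 0 < p - q by rewrite subr_gt0.
  rewrite ler_pdivlMr // ler_pdivrMr //.
  by move: pq; case: (ltrgt0P p) => ?; case: (ltrgt0P q) => // ? _; lra.
have [nu a01] := sep _ _ uv; have [_ b01] := sep _ _ xy.
(* Along the segment from [x] to [y] the function [orient u v] is affine; this is the parameter
   where it vanishes. *)
exists (orient u v x / (orient u v x - orient u v y)).
exists (orient x y u / (orient x y u - orient x y v)).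
have opp : orient x y u - orient x y v = - (orient u v x - orient u v y).
  by rewrite /orient; ring.
have solve (p q A B X V D : R) : D != 0 -> (p - q) * D + A * X + B * V = 0 ->
    p + A / D * X = q + B / - D * V.
  move=> D0 E; apply/eqP; rewrite -subr_eq0 -(mulrI_eq0 _ (mulfI D0)) -E.
  by apply/eqP; field.
by split=> //; rewrite opp; apply: solve; rewrite ?subr_eq0 // /orient; ring.
Qed.

Lemma general_perturbation (T : eqType) (U : seq T) (x : T -> R * R) (d : R) :
  0 < d -> exists z : T -> R * R,
    {in U, forall i, `|(z i).1 - (x i).1| <= d /\ `|(z i).2 - (x i).2| <= d} /\
    {in U & &, forall i j k, uniq [:: i; j; k] ->
       orient (z i) (z j) (z k) != 0}.
Proof.
move=> d0; pose c i : R := (index i U)%:R.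
have c_inj : {in U &, injective c}.
  move=> i j iU jU /eqP; rewrite eqr_nat => /eqP ij.
  by rewrite -(nth_index i iU) ij nth_index.
(* moving the points along a parabola makes the orientation of each triple a
   quadratic polynomial in the parameter, with a Vandermonde leading
   coefficient *)
pose X i : {poly R} := (x i).1%:P + c i *: 'X.
pose Y i : {poly R} := (x i).2%:P + (c i ^+ 2) *: 'X.
pose O i j k := (X j - X i) * (Y k - Y i) - (Y j - Y i) * (X k - X i).
pose z s i : R * R := ((x i).1 + c i * s, (x i).2 + c i ^+ 2 * s).
have OE i j k s : (O i j k).[s] = orient (z s i) (z s j) (z s k).
  by rewrite /O /X /Y /orient !hornerE.
have Onz i j k : i \in U -> j \in U -> k \in U -> uniq [:: i; j; k] -> O i j k != 0.
  move=> iU jU kU; rewrite /= !inE negb_or => /and3P[/andP[ij ik] jk _].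
  have : (c j - c i) * (c k - c i) * (c k - c j) != 0.
    have cn a b : a \in U -> b \in U -> a != b -> c b - c a != 0.
      by move=> aU bU; rewrite subr_eq0 eq_sym; apply: contra_neq; exact: c_inj.
    by rewrite !mulf_neq0 ?cn.
  apply: contraNneq => O0.
  (* The second difference at 1, 0 and -1 extracts twice the leading coefficient of the quadratic
     polynomial. *)
  have : orient (z 1 i) (z 1 j) (z 1 k) + orient (z (-1) i) (z (-1) j) (z (-1) k)
      - orient (z 0 i) (z 0 j) (z 0 k) *+ 2
    = ((c j - c i) * (c k - c i) * (c k - c j)) *+ 2.
    by rewrite /orient /z /=; ring.
  rewrite -!OE O0 !horner0 addr0 mul0rn subr0 => /esym/eqP.
  by rewrite mulrn_eq0.
pose ps := [seq O t.1.1 t.1.2 t.2 | t <- [seq (ij, k) | ij <- [seq (i, j) | i <- U, j <- U], k <- U] & uniq [:: t.1.1; t.1.2; t.2]].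
(* Both displacement factors, [c i] and its square, are at most the denominator, so a parameter up
   to [m] moves no coordinate by more than [d]. *)
pose m : R := d / (size U).+1%:R ^+ 2.
have m0 : 0 < m by rewrite divr_gt0 // exprn_gt0 // ltr0n.
have [|s [s0 sm snz]] := @exists_small_nonroot ps m m0.
  move=> p /mapP[[[i j] k] + ->]; rewrite mem_filter => /andP[/= u].
  case/allpairsP=> -[ij k'] [/= /allpairsP[[i' j'] [/= iU jU ->]] kU [ei ej ek]].
  by apply: Onz; rewrite // ?ei ?ej ?ek.
exists (z s); split.
  move=> i iU; rewrite /z /= ![_ + _ * s]addrC !addrK.
  have small t : 0 <= t <= (size U).+1%:R ^+ 2 -> `|t * s| <= d.
    move=> /andP[t0 tN]; rewrite ger0_norm ?mulr_ge0 ?(ltW s0) //.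
    apply: le_trans (ler_pM t0 (ltW s0) tN sm) _.
    by rewrite mulrC divfK // expf_neq0 // pnatr_eq0.
  have cN : c i <= (size U).+1%:R by rewrite ler_nat leqW // ltnW // index_mem.
  split; apply: small; rewrite ?exprn_ge0 ?ler0n //=.
    by rewrite (le_trans cN) // expr2 ler_peMr // ler1n.
  by rewrite lerXn2r // nnegrE ler0n.
move=> i j k iU jU kU u; rewrite -OE; apply: snz.
apply/mapP; exists ((i, j), k) => //; rewrite mem_filter u /=.
by apply: allpairs_f => //; apply: allpairs_f.
Qed.

End Perturbation.

From mathcomp Require Import all_classical all_reals all_analysis.
Import numFieldNormedType.Exports.
Local Open Scope classical_set_scope.

(** * Non-planarity of K5 *)

Section EpsChains.
Variable R : realType.
Implicit Types (x y z : R * R) (K L : set (R * R)) (d : R).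

(** A path at scale [d]. Unlike connectedness, it directly yields the finitely many corners of a
    polygonal line, and chains can be concatenated. *)
Definition eps_chain K d x y := exists s : seq (R * R),
  [/\ path (fun u v => `|u - v| < d) x s, last x s = y
    & forall u, u \in x :: s -> K u].

Lemma eps_chain_refl K d x : K x -> eps_chain K d x x.
Proof. by move=> Kx; exists [::]; split=> // u; rewrite inE => /eqP->. Qed.

Lemma eps_chain_trans K d y x z :
  eps_chain K d x y -> eps_chain K d y z -> eps_chain K d x z.
Proof.
move=> [s [ps ls Ks]] [t [pt lt Kt]]; exists (s ++ t); split.
- by rewrite cat_path ps ls.
- by rewrite last_cat ls.
- move=> u; rewrite -cat_cons mem_cat => /orP[/Ks//|ut].
  by apply: Kt; rewrite inE ut orbT.
Qed.

Lemma eps_chain_subset K L d x y :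
  K `<=` L -> eps_chain K d x y -> eps_chain L d x y.
Proof. by move=> KL [s [ps ls Ks]]; exists s; split=> // u /Ks/KL. Qed.

Lemma eps_chain_step K d x y : K x -> K y -> `|x - y| < d -> eps_chain K d x y.
Proof.
move=> Kx Ky xy; exists [:: y]; split; rewrite //= ?xy // => u.
by rewrite !inE => /orP[] /eqP->.
Qed.

(** The points reachable from [x] by chains form a nonempty subset of [K] that is both open and
    closed in [K]. *)
Lemma connected_eps_chain K d x y : connected K -> 0 < d -> K x -> K y ->
  eps_chain K d x y.
Proof.
move=> cK d0 Kx Ky; pose B := [set u | eps_chain K d x u].
have BK u : B u -> K u by case=> s [_ <- Ks]; apply: Ks; exact: mem_last.
suff BE : B = K by move: Ky; rewrite -{1}BE.
apply: cK.
- by exists x; exact: eps_chain_refl.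
- exists (\bigcup_(u in B) ball u d).
    by apply: bigcup_open => u _; exact: ball_open.
  apply/seteqP; split=> [u Bu|u [Ku [v Bv]]].
    by split; [exact: BK | exists u => //; exact: ballxx].
  rewrite -ball_normE /= => vu; apply: (eps_chain_trans Bv).
  by apply: eps_chain_step => //; exact: BK.
- exists (~` \bigcup_(u in K `\` B) ball u d).
    by apply: open_closedC; apply: bigcup_open => u _; exact: ball_open.
  apply/seteqP; split=> [u Bu|u [Ku nu]].
    split; first exact: BK.
    case=> v [Kv nBv]; rewrite -ball_normE /= => vu; apply: nBv.
    apply: (eps_chain_trans Bu); apply: eps_chain_step => //; first exact: BK.
    by rewrite distrC.
  by apply: contrapT => nBu; apply: nu; exists u => //; exact: ballxx.
Qed.

Definition separated_by K L d := forall x y, K x -> L y -> d <= `|x - y|.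

(** The distances between points of [K] and [L] form a compact set that misses 0. The conclusion is
    a filter statement, so that finitely many pairs of sets can share one [d]. *)
Lemma compact_separated K L : compact K -> compact L -> K `&` L = set0 ->
  \forall d \near 0^'+, separated_by K L d.
Proof.
move=> cK cL KL0; pose f (u : (R * R) * (R * R)) := `|u.1 - u.2|.
have cf : continuous f.
  by move=> u; apply: cvg_norm; apply: cvgB; [exact: cvg_fst | exact: cvg_snd].
have cS : closed (f @` (K `*` L)).
  apply: compact_closed; first exact: norm_hausdorff.
  by apply: continuous_compact; [exact: continuous_subspaceT | exact: compact_setX].
have : nbhs (0 : R) (~` (f @` (K `*` L))).
  apply: open_nbhs_nbhs; split; first exact: closed_openC.
  case=> -[x y] /= [Kx Ly]; rewrite /f /= => /eqP; rewrite normr_eq0 subr_eq0 => /eqP xy.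
  by have : (K `&` L) x by [split; rewrite // xy]; rewrite KL0.
case/nbhs_ballP => e /= e0 eS; near=> d => x y Kx Ly.
rewrite leNgt; apply/negP => xyd; apply: (eS `|x - y|); last by exists (x, y).
rewrite -ball_normE /= sub0r normrN normr_id (lt_trans xyd) //.
Unshelve. all: end_near. Qed.
End EpsChains.

Section TopologicalK5.
Variable R : realType.

Lemma polyline_path (T : eqType) (r : rel T) i (s : seq T) t :
  path r i s -> t \in polyline i s -> r t.1 t.2.
Proof.
elim: s i => // j s IH i /= /andP[rij rs].
by rewrite inE => /predU1P[-> //|]; exact: IH.
Qed.

Lemma prod_norm_lt (x : R * R) (d : R) :
  (`|x| < d) = (`|x.1| < d) && (`|x.2| < d).
Proof. by rewrite prod_normE gt_max. Qed.

Definition close_to (d : R) (x' x : R * R) :=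
  `|x'.1 - x.1| <= d /\ `|x'.2 - x.2| <= d.

(** In each coordinate the perturbed segments extend over at most d + 2 (d / 4) = 3 d / 2. A common
    point would be within 3 d / 2 + d / 4 = 7 d / 4 of both [x] and [u], which would then differ by
    at most 7 d / 2 < 4 d. *)
Lemma cross_close (K L : set (R * R)) (d : R) (x y u v x' y' u' v' : R * R) :
    0 < d -> separated_by K L (d *+ 4) -> K x -> L u ->
    `|x - y| < d -> `|u - v| < d ->
    close_to (d / 4) x' x -> close_to (d / 4) y' y ->
    close_to (d / 4) u' u -> close_to (d / 4) v' v ->
  cross x' y' u' v' = false.
Proof.
move=> d0 sep Kx Lu; rewrite !prod_norm_lt.
move=> /andP[xy1 xy2] /andP[uv1 uv2] [x1 x2] [y1 y2] [u1 u2] [v1 v2].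
apply: contraTF (sep _ _ Kx Lu) => /cross_meet[a [b [a01 b01 e1 e2]]].
rewrite -ltNge prod_norm_lt.
have key (s t w r s' t' w' r' : R) : s' + a * (t' - s') = w' + b * (r' - w') ->
    `|s - t| < d -> `|w - r| < d -> `|s' - s| <= d / 4 -> `|t' - t| <= d / 4 ->
    `|w' - w| <= d / 4 -> `|r' - r| <= d / 4 -> `|s - w| < d *+ 4.
  have sm (c h h' g g' : R) : 0 <= c <= 1 -> `|h - g| < d -> `|h' - h| <= d / 4 ->
      `|g' - g| <= d / 4 -> - (d * 3 / 2) <= c * (g' - h') <= d * 3 / 2.
    move=> /andP[c0 c1]; rewrite -ler_norml normrM (ger0_norm c0) => hg h'h g'g.
    rewrite (le_trans (ler_piMl (normr_ge0 _) c1)) //.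
    by move: hg h'h g'g; rewrite ltr_norml !ler_norml; lra.
  move=> e st wr s's t't w'w r'r.
  have := sm _ _ _ _ _ a01 st s's t't; have := sm _ _ _ _ _ b01 wr w'w r'r.
  move: e s's w'w; move: (a * _) (b * _) => A B.
  by rewrite !ler_norml ltr_norml; lra.
apply/andP; split; [exact: key e1 xy1 uv1 x1 y1 u1 v1|exact: key e2 xy2 uv2 x2 y2 u2 v2].
Qed.

Lemma no_planar_K5 (p : nat -> R * R) (K : nat -> nat -> set (R * R)) :
  (forall m n, (m < n < 5)%N -> compact (K m n)) ->
  (forall m n, (m < n < 5)%N -> forall d, 0 < d ->
     eps_chain (K m n) d (p m) (p n)) ->
  (forall m n m' n', (m < n < 5)%N -> (m' < n' < 5)%N ->
     uniq [:: m; n; m'; n'] -> K m n `&` K m' n' = set0) -> False.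
Proof.
move=> cK chainK disjK.
have [d [d0 sepK]] : exists d : R, 0 < d /\ forall m n m' n', (m < n < 5)%N ->
    (m' < n' < 5)%N -> uniq [:: m; n; m'; n'] ->
    separated_by (K m n) (K m' n') (d *+ 4).
  have : \forall d \near 0^'+, forall t : ('I_5 * 'I_5) * ('I_5 * 'I_5),
      (t.1.1 < t.1.2)%N -> (t.2.1 < t.2.2)%N ->
      uniq [:: t.1.1 : nat; t.1.2 : nat; t.2.1 : nat; t.2.2 : nat] ->
      separated_by (K t.1.1 t.1.2) (K t.2.1 t.2.2) d.
    apply: filter_forall => -[[m n] [m' n']] /=.
    have [mn|_] := boolP (m < n)%N; last by apply: nearW.
    have [m'n'|_] := boolP (m' < n')%N; last by apply: nearW.
    have /= [u|_] := boolP (uniq [:: m : nat; n : nat; m' : nat; n' : nat]);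
      last by apply: nearW.
    have mn5 : (m < n < 5)%N by rewrite mn ltn_ord.
    have m'n'5 : (m' < n' < 5)%N by rewrite m'n' ltn_ord.
    by apply: filterS (compact_separated (cK _ _ mn5) (cK _ _ m'n'5) (disjK _ _ _ _ mn5 m'n'5 u)).
  move=> near0; near (0 : R)^'+ => d; exists (d / 4); split.
    by rewrite divr_gt0.
  move=> m n m' n' /andP[mn n5] /andP[m'n' n'5] u.
  have -> : (d / 4) *+ 4 = d by rewrite -[_ *+ 4]mulr_natr divfK.
  pose t := ((Ordinal (ltn_trans mn n5), Ordinal n5), (Ordinal (ltn_trans m'n' n'5), Ordinal n'5)).
  have : forall t : ('I_5 * 'I_5) * ('I_5 * 'I_5),
      (t.1.1 < t.1.2)%N -> (t.2.1 < t.2.2)%N ->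
      uniq [:: t.1.1 : nat; t.1.2 : nat; t.2.1 : nat; t.2.2 : nat] ->
      separated_by (K t.1.1 t.1.2) (K t.2.1 t.2.2) d by near: d.
  by move=> /(_ t); apply.
have /choice[L Lchain] : forall e : nat * nat, exists s : seq (R * R),
    (e.1 < e.2 < 5)%N ->
    [/\ path (fun u v => `|u - v| < d) (p e.1) s, last (p e.1) s = p e.2
      & forall u, u \in p e.1 :: s -> K e.1 e.2 u].
  move=> [m n] /=; have [mn|_] := boolP (m < n < 5)%N; last by exists [::].
  by have [s sP] := chainK m n mn d d0; exists s.
(* the i-th interior point of the chain of the edge mn has index (m, n, i), and
   the vertex m has index (m, m, 0) *)
pose x (i : nat * nat * nat) :=
  if i.1.1 == i.1.2 then p i.1.1 else nth 0 (L i.1) i.2.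
pose v (m : nat) := (m, m, 0%N).
(* Lines are lists of indices because a chain may revisit a point, while the perturbation separates
   distinct indices. The chain already ends at [p n]; the extra index [v n], shared by all edges at
   [n], costs a step of length 0. *)
pose q m n := rcons [seq (m, n, i) | i <- iota 0 (size (L (m, n)))] (v n).
have qL m n : (m < n < 5)%N -> map x (q m n) = rcons (L (m, n)) (p n).
  move=> /andP[mn _]; rewrite map_rcons /x /= eqxx -map_comp /comp /= ltn_eqF //.
  by congr rcons; exact: (mkseq_nth 0 (L (m, n))).
pose U := flatten [seq v m :: q m n | m <- iota 0 5, n <- iota 0 5].
have d4 : 0 < d / 4 by rewrite divr_gt0.
have [z [zx zgen]] := @general_perturbation R _ U x _ d4.
have U5 m n : (m < n < 5)%N -> {subset v m :: q m n <= U}.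
  move=> /andP[mn n5] i iq; apply/flattenP; exists (v m :: q m n) => //.
  by apply: allpairs_f; rewrite mem_iota // (ltn_trans mn).
have mem_q m n t : t \in v m :: q m n ->
    [\/ t = v m, t = v n | exists i, t = (m, n, i)].
  rewrite inE mem_rcons inE => /or3P[/eqP-> | /eqP-> | /mapP[i _ ->]].
  - exact: Or31.
  - exact: Or32.
  - by apply: Or33; exists i.
have step m n t : (m < n < 5)%N -> t \in polyline (v m) (q m n) ->
    [/\ `|x t.1 - x t.2| < d, K m n (x t.1), t.1 \in U & t.2 \in U].
  move=> mn tq; have [pL lL KL] := Lchain (m, n) mn.
  have /andP[t1 t2] := mem_polyline tq; split; [| |exact: U5 t1|exact: U5 t2].
    have : path (fun u v => `|u - v| < d) (x (v m)) (map x (q m n)).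
      by rewrite qL // {1}/x eqxx rcons_path pL lL subrr normr0 d0.
    by rewrite path_map => /polyline_path /(_ tq).
  apply: KL; have : x t.1 \in map x (v m :: q m n) by apply: map_f.
  rewrite map_cons qL // {2}/x eqxx inE mem_rcons inE => /or3P[].
  - by rewrite inE => ->.
  - by rewrite -lL => /eqP->; exact: mem_last.
  - by rewrite inE orbC => ->.
apply: (@no_planar_polygonal_K5 R _ z U zgen v q) => //.
- by move=> m n /andP[mn _]; rewrite xpair_eqE negb_and xpair_eqE ltn_eqF.
- move=> m n /andP[mn _]; split=> //; first by rewrite last_rcons.
  rewrite cons_uniq rcons_uniq mem_rcons inE negb_or !xpair_eqE ltn_eqF //=.
  rewrite map_inj_uniq ?iota_uniq => [|i j []//]; rewrite andbT.
  by apply/andP; split; apply/mapP => -[i _ [*]]; lia.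
- move=> m n m' n' /andP[mn _] /andP[m'n' _]; rewrite /= !inE !negb_or.
  move=> /and4P[/and3P[/eqP? /eqP? /eqP?] /andP[/eqP? /eqP?] /eqP? _] t.
  move=> /mem_q t1; apply/negP => /mem_q.
  case: t1 => [->|->|[i ->]] [e|e|[j e]]; case: e => *; subst; lia.
- move=> m n m' n' mn m'n' u; rewrite /crossings big1_seq // => -[i j] /= ij.
  have [xij Ki iU jU] := step _ _ _ mn ij.
  rewrite big1_seq // => -[k l] /= kl.
  have [xkl Kk kU lU] := step _ _ _ m'n' kl.
  by apply: (cross_close d0 (sepK _ _ _ _ mn m'n' u) Ki Kk xij xkl); apply: zx.
Unshelve. all: end_near. Qed.
End TopologicalK5.

(** * Paths between vertices on a face *)

Section Disc.
Variable R : realType.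
Implicit Types (a b c d t : R).

Definition polar t a : R * R := (t * cos a, t * sin a).
Definition circle_arc a b : set (R * R) := polar 1 @` `[a, b].
Definition radius a : set (R * R) := polar^~ a @` `[0, 1].

Lemma unit_disc_polar t a : 0 <= t <= 1 -> unit_disc (polar t a).
Proof.
move=> /andP[t0 t1]; rewrite /unit_disc /= !exprMn -mulrDr cos2Dsin2 mulr1.
by rewrite expr_le1.
Qed.

Lemma polar_radius_inj t a b : 0 <= t -> polar t a = polar 1 b -> t = 1.
Proof.
move=> t0 [e1 e2]; apply/eqP; rewrite -sqrp_eq1 //; apply/eqP.
have : (t * cos a) ^+ 2 + (t * sin a) ^+ 2 = (1 * cos b) ^+ 2 + (1 * sin b) ^+ 2.
  by rewrite e1 e2.
by rewrite !exprMn -!mulrDr !cos2Dsin2 !mulr1 expr1n.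
Qed.

Lemma polar_angle_inj a b : a < b -> b < a + 2 * pi -> polar 1 a <> polar 1 b.
Proof.
move=> ab ba; rewrite /polar !mul1r => -[ec es].
have : cos (b - a) = 1 by rewrite cosB ec es -!expr2 cos2Dsin2.
(* Half the difference lies strictly between 0 and pi, where the sine is positive, so the cosine of
   the difference is less than 1. *)
have -> : b - a = ((b - a) / 2) *+ 2 by rewrite -[_ *+ 2]mulr_natr divfK.
have : 0 < sin ((b - a) / 2).
  by apply: sin_gt0_pi; rewrite divr_gt0 ?subr_gt0 //= ltr_pdivrMr // mulrC ltrBlDl.
rewrite cos_mulr2n; have := cos2Dsin2 ((b - a) / 2); nra.
Qed.

Lemma circle_arcs_disjoint a b c d : b < c -> d < a + 2 * pi ->
  circle_arc a b `&` circle_arc c d = set0.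
Proof.
move=> bc da; rewrite -subset0 => _ [[x xI <-] [y yI xy]]; move: xI yI; rewrite /= !in_itv /=.
move=> /andP[ax xb] /andP[cy yd]; apply: (@polar_angle_inj x y); last by [].
  exact: le_lt_trans xb (lt_le_trans bc cy).
by rewrite (le_lt_trans yd) // (lt_le_trans da) // lerD2r.
Qed.

(** A radius meets the circle only in its tip, written as a degenerate arc so that
    [circle_arcs_disjoint] settles this case too. *)
Lemma radius_arc_disjoint a c d : circle_arc a a `&` circle_arc c d = set0 ->
  radius a `&` circle_arc c d = set0.
Proof.
move=> ad0; rewrite -subset0 => _ [[t tI <-] [y yd yt]]; move: tI; rewrite /= in_itv /=.
move=> /andP[t0 _]; have t1 := polar_radius_inj t0 (esym yt).
suff : (circle_arc a a `&` circle_arc c d) (polar t a) by rewrite ad0.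
split; last by exists y => //; exact: yt.
by exists a; rewrite ?t1 //= in_itv /= lexx.
Qed.

Lemma continuous_polar a : continuous (polar^~ a).
Proof.
move=> t; have ct c : (fun u => u * c) @ t --> t * c.
  by apply: cvgMr_tmp; exact: cvg_id.
exact: cvg_pair (ct _) (ct _).
Qed.

Lemma continuous_circle : continuous (polar 1).
Proof.
move=> t; have cc : (fun u => 1 * cos u) @ t --> 1 * cos t.
  by apply: cvgMl_tmp; exact: continuous_cos.
have cs : (fun u => 1 * sin u) @ t --> 1 * sin t.
  by apply: cvgMl_tmp; exact: continuous_sin.
exact: cvg_pair cc cs.
Qed.

Lemma compact_radius a : compact (radius a).
Proof.
apply: continuous_compact; last exact: segment_compact.
exact/continuous_subspaceT/continuous_polar.
Qed.

Lemma compact_circle_arc a b : compact (circle_arc a b).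
Proof.
apply: continuous_compact; last exact: segment_compact.
exact/continuous_subspaceT/continuous_circle.
Qed.

Lemma connected_radius a : connected (radius a).
Proof.
apply: connected_continuous_connected; first exact: segment_connected.
exact/continuous_subspaceT/continuous_polar.
Qed.

Lemma connected_circle_arc a b : connected (circle_arc a b).
Proof.
apply: connected_continuous_connected; first exact: segment_connected.
exact/continuous_subspaceT/continuous_circle.
Qed.

Lemma radius_unit_disc a : radius a `<=` @unit_disc R.
Proof. by move=> _ [t tI <-]; move: tI; rewrite /= in_itv /=; exact: unit_disc_polar. Qed.

Lemma circle_arc_unit_disc a b : circle_arc a b `<=` @unit_disc R.
Proof. by move=> _ [t _ <-]; apply: unit_disc_polar; rewrite ler01 lexx. Qed.

End Disc.

(** The order of the list is that of the final cases of [face_no_crossing]. *)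
Lemma independent_K5_edges m n m' n' :
    (m < n < 5)%N -> (m' < n' < 5)%N -> uniq [:: m; n; m'; n'] -> (m < m')%N ->
  (m', n', m, n) \in [:: (2, 3, 0, 1); (2, 4, 0, 1); (3, 4, 0, 1);
    (1, 3, 0, 2); (1, 4, 0, 2); (3, 4, 0, 2); (1, 2, 0, 3); (1, 4, 0, 3);
    (2, 4, 0, 3); (1, 2, 0, 4); (1, 3, 0, 4); (2, 3, 0, 4); (3, 4, 1, 2);
    (2, 4, 1, 3); (2, 3, 1, 4)]%N.
Proof.
case: n => [|[|[|[|[|n]]]]] /andP[]; case: m => [|[|[|[|m]]]] // _ _;
case: n' => [|[|[|[|[|n']]]]] /andP[]; case: m' => [|[|[|[|m']]]] //.
Qed.

Section FaceCrossing.
Variables (R : realType) (G : graph) (P : plane_embedding R G).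
Variables (f : set (R * R)) (s : seq (vertex G)).

Lemma is_face_drawing : is_face P f -> f `&` drawing P = set0.
Proof.
case=> z _ ->; rewrite -subset0 => u [].
by move/(@connected_component_sub _ _ _ _).
Qed.

(** Each of the four circle arcs shares a vertex with edge 02 and with edge 13, so only the radii
    have to be kept apart from [A] and [B]. *)
Lemma face_no_crossing : is_face P f -> in_cyclic_order P f s ->
  exists theta : vertex G -> R, sorted (fun u v => theta u < theta v) s /\
  forall v0 v1 v2 v3 (A B : set (R * R)),
    [/\ v0 \in s, v1 \in s, v2 \in s & v3 \in s] ->
    [/\ theta v0 < theta v1, theta v1 < theta v2 & theta v2 < theta v3] ->
    compact A -> compact B -> A `<=` drawing P -> B `<=` drawing P ->
    (forall d, 0 < d -> eps_chain A d (pos P v0) (pos P v2)) ->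
    (forall d, 0 < d -> eps_chain B d (pos P v1) (pos P v3)) ->
    A `&` B !=set0.
Proof.
move=> /is_face_drawing fD [h [theta [ch ih st sth hf]]]; exists theta; split=> //.
move=> v0 v1 v2 v3 A B [s0 s1 s2 s3] [t01 t12 t23] cA cB AD BD chA chB.
apply/set0P/negP => /eqP AB0.
have hs v : v \in s -> h (polar 1 (theta v)) = pos P v.
  by move=> /sth[_]; rewrite /polar !mul1r.
have t3 : theta v3 < theta v0 + 2 * pi.
  have [/andP[_ t3] _] := sth _ s3; have [/andP[t0 _] _] := sth _ s0.
  by apply: lt_le_trans t3 _; rewrite lerDr.
(* [v 3] is [v3] through the default value. *)
pose v (m : nat) := nth v3 [:: v0; v1; v2] m.
(* K5: the four vertices and the centre of the disc, numbered 4, joined by A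
   (edge 02), B (edge 13), radii and circle arcs *)
pose D (m n : nat) : set (R * R) :=
  if n == 4%N then radius (theta (v m))
  else if m.+1 == n then circle_arc (theta (v m)) (theta (v n))
  (* The arc of edge 03, from [v3] through the angle 2 pi back to [v0]. *)
  else circle_arc (theta (v n)) (theta (v m) + 2 * pi).
pose K (m n : nat) := if (m, n) == (0, 2)%N then A else if (m, n) == (1, 3)%N then B
  else h @` D m n.
pose p (m : nat) := if m == 4%N then h (0, 0) else pos P (v m).
have chain_image (E : set (R * R)) x y x' y' d : E `<=` @unit_disc R ->
    connected E -> E x -> E y -> h x = x' -> h y = y' -> 0 < d ->
    eps_chain (h @` E) d x' y'.
  move=> Edisc cE Ex Ey <- <- d0; apply: connected_eps_chain => //.
  apply: connected_continuous_connected => //.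
  exact: continuous_subspaceW ch.
have DU m n : D m n `<=` @unit_disc R.
  rewrite /D; case: ifP => _; first exact: radius_unit_disc.
  by case: ifP => _; exact: circle_arc_unit_disc.
have inD0 (E F : set (R * R)) : E `<=` @unit_disc R -> F `<=` @unit_disc R ->
    E `&` F = set0 -> h @` E `&` h @` F = set0.
  move=> EU FU EF0; rewrite -subset0 => _ [[x Ex <-] [y Fy xy]].
  have yx : y = x by apply: ih => //; rewrite inE; [exact: FU|exact: EU].
  by have : (E `&` F) y by [split; rewrite // yx]; rewrite EF0.
(* A point of the radius lying on the drawing is not in [f], so it is a vertex of [s]; by
   injectivity of [h] it comes from the circle, so it is the tip, [pos P u]. *)
have rad (C : set (R * R)) (u : vertex G) : C `<=` drawing P -> u \in s ->
    ~ C (pos P u) -> C `&` h @` radius (theta u) = set0.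
  move=> CD us nCu; rewrite -subset0 => y [Cz [z zr zy]]; move: Cz; rewrite -zy => Cz.
  case: (hf _ (radius_unit_disc zr)) => [fz|[w' ws hz]].
    by have : (f `&` drawing P) (h z) by [split=> //; exact: CD]; rewrite fD.
  apply: nCu; rewrite -hs //.
  have zw : z = polar 1 (theta w').
    apply: ih; rewrite ?inE ?hs //; first exact: radius_unit_disc zr.
    by apply: unit_disc_polar; rewrite ler01 lexx.
  case: zr Cz zw => t; rewrite /= in_itv /= => /andP[t0' _] <- Cz zw.
  by rewrite (polar_radius_inj t0' zw) in Cz.
apply: (@no_planar_K5 R p K).
- move=> m n _; rewrite /K; case: ifP => // _; case: ifP => // _.
  apply: continuous_compact; first exact: continuous_subspaceW ch.
  rewrite /D; case: ifP => _; first exact: compact_radius.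
  by case: ifP => _; exact: compact_circle_arc.
- have r0 a : radius a (0, 0) by exists 0; rewrite ?/polar ?mul0r //= in_itv /= lexx ler01.
  have r1 a : radius a (polar 1 a) by exists 1; rewrite //= in_itv /= lexx ler01.
  have cl a b : a <= b -> circle_arc a b (polar 1 a).
    by move=> ab; exists a; rewrite //= in_itv /= lexx ab.
  have cr a b : a <= b -> circle_arc a b (polar 1 b).
    by move=> ab; exists b; rewrite //= in_itv /= lexx ab.
  have per a : polar 1 (a + 2 * pi) = polar 1 a.
    by rewrite /polar mulr_natl cosD2pi sinD2pi.
  have vs m : v m \in s.
    rewrite /v; case: (ltnP m 3) => m3; last by rewrite nth_default.
    by case: m m3 => [|[|[|]]].
  have pv m : (m < 4)%N -> h (polar 1 (theta (v m))) = p m.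
    by move=> m4; rewrite /p ltn_eqF // hs.
  move=> m n /andP[mn n5] d d0; rewrite /K.
  case: ifP => [/eqP[-> ->]|ne02]; first exact: chA.
  case: ifP => [/eqP[-> ->]|ne13]; first exact: chB.
  have [e4|n4] := eqVneq n 4%N.
    apply: (chain_image _ (polar 1 (theta (v m))) (0, 0)) => //; rewrite ?e4 //.
    + exact: connected_radius.
    + exact: r1.
    + exact: r0.
    + by apply: pv; rewrite -e4.
  have {n4}n5 : (n < 4)%N by rewrite ltn_neqAle n4 -ltnS.
  rewrite /D ifN; last by rewrite ltn_eqF.
  have [en|ne] := eqVneq m.+1 n.
    apply: (chain_image _ (polar 1 (theta (v m))) (polar 1 (theta (v n)))) => //.
    + exact: circle_arc_unit_disc.
    + exact: connected_circle_arc.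
    + apply: cl; rewrite -en; move: en n5 => <-; rewrite ltnS.
      by case: m {mn ne02 ne13} => [|[|[|]]] //= _; exact: ltW.
    + apply: cr; rewrite -en; move: en n5 => <-; rewrite ltnS.
      by case: m {mn ne02 ne13} => [|[|[|]]] //= _; exact: ltW.
    + by apply: pv; exact: ltn_trans mn n5.
    + exact: pv.
  have [-> ->] : m = 0%N /\ n = 3%N.
    by case: m n {vs pv} mn n5 ne ne02 ne13 => [|[|[|m]]] [|[|[|[|n]]]].
  apply: (chain_image _ (polar 1 (theta v0 + 2 * pi)) (polar 1 (theta v3))) => //.
  + exact: circle_arc_unit_disc.
  + exact: connected_circle_arc.
  + by apply: cr; exact: ltW.
  + by apply: cl; exact: ltW.
  + by rewrite per; exact: (pv 0%N).
  + exact: (pv 3%N).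
move=> m n m' n'.
have endpoint (C : set (R * R)) x y : (forall d, 0 < d -> eps_chain C d x y) -> C x /\ C y.
  by case/(_ 1 ltr01) => t [_ <- Ct]; split; apply: Ct; rewrite ?mem_head ?mem_last.
have [A0 A2] := endpoint _ _ _ chA; have [B1 B3] := endpoint _ _ _ chB.
have notA x : B x -> ~ A x.
  by move=> Bx Ax; have : (A `&` B) x by []; rewrite AB0.
have notB x : A x -> ~ B x by move=> Ax /notA; exact.
have [t02 t13] : theta v0 < theta v2 /\ theta v1 < theta v3.
  by split; [exact: lt_trans t12 | exact: lt_trans t23].
have t03 := lt_trans t01 t13.
have pi0 := pi_gt0 R.
have arcs a b c d : b < c -> d < a + 2 * pi ->
  h @` circle_arc a b `&` h @` circle_arc c d = set0.
  by move=> bc da; apply: inD0 (circle_arcs_disjoint bc da); exact: circle_arc_unit_disc.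
have radarc a c d : (a < c /\ d < a + 2 * pi) \/ (d < a /\ a < c + 2 * pi) ->
  h @` radius a `&` h @` circle_arc c d = set0.
  move=> acd; apply: inD0; [exact: radius_unit_disc|exact: circle_arc_unit_disc|].
  apply: radius_arc_disjoint; case: acd => [[? ?]|[? ?]].
    exact: circle_arcs_disjoint.
  by rewrite setIC; exact: circle_arcs_disjoint.
wlog mm' : m n m' n' / (m < m')%N.
  move=> wl mn m'n' u; have [mm'|m'm|e] := ltngtP m m'.
  - exact: wl.
  - rewrite setIC; apply: wl => //.
    by rewrite -(rot_uniq 2).
  - by move: u; rewrite /= e !inE eqxx !orbT.
move=> mn m'n' u.
have := independent_K5_edges mn m'n' u mm'.
rewrite setIC !inE; do 14?[case/orP] => /eqP[-> -> -> ->].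
- by rewrite setIC; apply: arcs; rewrite /v /=; lra.
- by apply: radarc; right; rewrite /v /=; split; lra.
- by apply: radarc; right; rewrite /v /=; split; lra.
- by rewrite setIC.
- by rewrite setIC; apply: rad => //; exact: notA.
- by rewrite setIC; apply: rad => //; exact: notA.
- by apply: arcs; rewrite /v /=; lra.
- by apply: radarc; left; rewrite /v /=; split; lra.
- by apply: radarc; left; rewrite /v /=; split; lra.
- by rewrite setIC; apply: radarc; left; rewrite /v /=; split; lra.
- by apply: rad => //; exact: notB.
- by rewrite setIC; apply: radarc; left; rewrite /v /=; split; lra.
- by apply: radarc; right; rewrite /v /=; split; lra.
- by rewrite setIC; apply: rad => //; exact: notB.
- by rewrite setIC; apply: radarc; left; rewrite /v /=; split; lra.
Qed.

End FaceCrossing.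

(** * Drawings of components as compact sets *)

Section ComponentDrawing.
Variables (R : realType) (G : graph) (P : plane_embedding R G).
Implicit Types (F : {set edge G}) (C : {set vertex G}) (u v : vertex G).

(** The vertices are listed separately so that a component without edges is drawn as well. *)
Definition component_drawing F C : set (R * R) :=
  \bigcup_(v in [set` C]) [set pos P v] `|`
  \bigcup_(x in [set` [set x in F | ends x \subset C]%SET]) (arc P x @` `[0, 1]).

Lemma arc_point x (t : R) : t \in `[0, 1] ->
  (t \in `]0, 1[) \/ exists2 v, v \in ends x & arc P x t = pos P v.
Proof.
have [u [v [-> e0 e1]]] := arc_ends P x.
rewrite !mem_setE !in_itv /= => /andP[t0 t1].
have [->|n0] := eqVneq t 0; first by right; exists u; rewrite ?inE ?eqxx.
have [->|n1] := eqVneq t 1; first by right; exists v; rewrite ?inE ?eqxx ?orbT.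
by left; rewrite !lt_neqAle t0 t1 n1 eq_sym n0.
Qed.

Lemma component_drawing_sub F C : component_drawing F C `<=` drawing P.
Proof.
move=> z [[v _ ->]|[x _ xz]]; first by left; exists v.
by right; exists x.
Qed.

Lemma compact_component_drawing F C : compact (component_drawing F C).
Proof.
apply: compactU; rewrite bigcup_pred; apply: bigsetU_compact => i _.
  exact: compact_set1.
apply: continuous_compact; [exact: arc_continuous | exact: segment_compact].
Qed.

(** Two points drawn at the same place are either interior to the same arc or the same vertex; both
    are excluded since an arc drawn for [C] has its two ends in [C]. *)
Lemma component_drawing_disjoint F C C' : (forall v, v \in C -> v \notin C') ->
  component_drawing F C `&` component_drawing F C' = set0.
Proof.
move=> dis; have no v : v \in C -> v \in C' -> False.
  by move=> /dis/negP.
have arcv x t v (D D' : {set vertex G}) : (forall v, v \in D -> v \in D' -> False) ->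
    ends x \subset D -> t \in `[0, 1] -> arc P x t = pos P v -> v \in D' -> False.
  move=> noD xD tI e vD'; have [tI'|[w wx ew]] := arc_point x tI.
    exact: (arc_vertex tI' e).
  by apply: (noD v) => //; rewrite -(pos_inj (etrans (esym ew) e)) (fintype.subsetP xD).
have memC D x : x \in [set x in F | ends x \subset D]%SET -> ends x \subset D.
  by rewrite inE => /andP[].
rewrite -subset0 => z [[[v vC ->]|[x /memC xC [t /mem_set tI <-]]]].
  case=> [[v' v'C' /pos_inj e]|[y /memC yC' [t /mem_set tI tv]]].
    by apply: (no v); rewrite // e.
  by apply: (arcv y t v C' C) => // w wC' wC; exact: no wC wC'.
case=> [[v vC' e]|[y /memC yC' [t' /mem_set t'I e]]].
  exact: (arcv x t v C C').
have xy : x != y.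
  apply: contraTneq isT => xy; have [u [v [xE _ _]]] := arc_ends P x.
  have ux : u \in ends x by rewrite xE !inE eqxx.
  by case: (no u); [exact: (fintype.subsetP xC) | apply: (fintype.subsetP yC'); rewrite -xy].
have [tI'|[w wx e']] := arc_point x tI; last first.
  apply: (arcv y t' w C' C) => //; last exact: (fintype.subsetP xC).
    by move=> v vC' vC; exact: no vC vC'.
  by rewrite e.
have [t'I'|[w wy e']] := arc_point y t'I; last first.
  by apply: (arcv x t w C C') => //; [rewrite -e|exact: (fintype.subsetP yC')].
exact: (arc_disjoint xy tI' t'I' (esym e)).
Qed.

Lemma connect_eps_chain F u v d : 0 < d -> connect (adjacent_in F) u v ->
  eps_chain (component_drawing F [set w | connect (adjacent_in F) u w]%SET) d
    (pos P u) (pos P v).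
Proof.
move=> d0 /connectP[p]; elim/last_ind: p v => [|p w IH] v /=.
  by move=> _ ->; apply: eps_chain_refl; left; exists u; rewrite //= inE.
rewrite rcons_path last_rcons => /andP[up /existsP[x /andP[xF /eqP xE]]] ->.
apply: eps_chain_trans (IH _ up erefl) _.
have ul : connect (adjacent_in F) u (last u p) by apply/connectP; exists p.
have uw : connect (adjacent_in F) u w.
  apply: connect_trans ul (connect1 _); apply/existsP; exists x.
  by rewrite xF xE eqxx.
have arcK : arc P x @` `[0, 1] `<=`
    component_drawing F [set w | connect (adjacent_in F) u w]%SET.
  move=> z xz; right; exists x; rewrite //= inE xF xE; apply/fintype.subsetP => y.
  by rewrite !inE => /orP[] /eqP->.
apply: eps_chain_subset arcK _; apply: connected_eps_chain => //.
- apply: connected_continuous_connected; first exact: segment_connected.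
  exact: arc_continuous.
- have [a [b [abE a0 b1]]] := arc_ends P x.
  have : last u p \in ends x by rewrite xE !inE eqxx.
  rewrite abE !inE => /orP[]/eqP->; [exists 0|exists 1] => //=; by rewrite in_itv /= ?lexx ?ler01.
- have [a [b [abE a0 b1]]] := arc_ends P x.
  have : w \in ends x by rewrite xE !inE eqxx orbT.
  rewrite abE !inE => /orP[]/eqP->; [exists 0|exists 1] => //=; by rewrite in_itv /= ?lexx ?ler01.
Qed.

(** If [v0] and [v1] lay in different components, the drawings of these would be disjoint compact
    sets contradicting [face_no_crossing]. *)
Lemma face_noncrossing f (s : seq (vertex G)) :
  is_face P f -> in_cyclic_order P f s ->
  exists theta : vertex G -> R, sorted (fun u v => theta u < theta v) s /\
  forall F v0 v1 v2 v3,
    [/\ v0 \in s, v1 \in s, v2 \in s & v3 \in s] ->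
    [/\ theta v0 < theta v1, theta v1 < theta v2 & theta v2 < theta v3] ->
    connect (adjacent_in F) v0 v2 -> connect (adjacent_in F) v1 v3 ->
    connect (adjacent_in F) v0 v1.
Proof.
move=> face order; have [theta [st nc]] := face_no_crossing face order.
exists theta; split=> // F v0 v1 v2 v3 vs vt c02 c13; apply: contrapT => nc01.
pose C u := [set w | connect (adjacent_in F) u w]%SET.
have : component_drawing F (C v0) `&` component_drawing F (C v1) !=set0.
  apply: (nc v0 v1 v2 v3) => //; try exact: compact_component_drawing;
    try exact: component_drawing_sub; by move=> d d0; exact: connect_eps_chain.
rewrite component_drawing_disjoint; first by case.
move=> w; rewrite !inE => c0w; apply/negP => c1w; apply: nc01.
by apply: connect_trans c0w _; rewrite connect_adjacent_sym.
Qed.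

End ComponentDrawing.

Local Close Scope classical_set_scope.

Theorem theorem4p4 (R : realType) (G : graph) (w : edge G -> R)
    (P : plane_embedding R G) (f : set (R * R)) (k : nat)
    (a b : 'I_k -> vertex G) (e : 'I_k -> edge G) :
  (forall x, w x != 0) ->
  ~~ odd #|vertex G| ->
  is_face P f ->
  (2 <= k)%N ->
  (forall i, ends (e i) = [set a i; b i]%SET) ->
  (forall i i', i != i' -> [disjoint ends (e i) & ends (e i')]) ->
  (forall i, edge_in_boundary P f (e i)) ->
  in_cyclic_order P f (flatten [seq [:: a i; b i] | i <- enum 'I_k]) ->
  let X := [set e i | i : 'I_k]%SET in
  let GmX := del_edges (whole G) X in
  forall j : 'I_k,
  M w (whole G) * M w GmX =
    M w (del_edges (whole G) [set e j]%SET)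
      * M w (del_edges (whole G) (X :\ e j)%SET)
    + w (e j) * \sum_(i < k | i != j) w (e i) *
        (M w (del_vertices (whole G) [set b j; a i]%SET)
           * M w (del_vertices GmX [set a j; b i]%SET)
         - M w (del_vertices (whole G) [set b j; b i]%SET)
           * M w (del_vertices GmX [set a j; a i]%SET)).
Proof.
move=> _ _ face _ ends_e ends_disjoint _ order X GmX j.
have [theta [theta_sorted noncrossing]] := face_noncrossing face order.
(* Every subgraph in the statement is determined by its deleted edges [Y] and deleted vertices
   [S]. *)
have ME (H : subgraph G) (Y : {set edge G}) (S : {set vertex G}) :
    vset H = (~: S)%SET ->
    (forall x, (x \in eset H) = (x \notin Y) && [disjoint ends x & S]) ->
    M w H = matching_sum w (~: Y)%SET S.
  by move=> vH eH; apply: eq_bigl => m; exact: perfect_matchingE.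
have del Y S : M w (del_vertices (del_edges (whole G) Y) S) =
    matching_sum w (~: Y)%SET S.
  apply: ME => [|x]; first by rewrite /= finset.setTD.
  by rewrite !inE andbT.
have delE Y : M w (del_edges (whole G) Y) =
    matching_sum w (~: Y)%SET finset.set0.
  apply: ME => [|x]; first by rewrite /= finset.setC0.
  by rewrite !inE (disjoint_set0 _).2 !andbT.
have delV S : M w (del_vertices (whole G) S) = matching_sum w finset.setT S.
  rewrite -finset.setC0; apply: ME => [|x]; first by rewrite /= finset.setTD.
  by rewrite !inE.
have wholeE : M w (whole G) = matching_sum w finset.setT finset.set0.
  rewrite -[finset.setT]finset.setC0; apply: ME => [|x].
    by rewrite /= finset.setC0.
  by rewrite !inE (disjoint_set0 _).2.
rewrite wholeE /GmX !delE.
under eq_bigr => i _ do rewrite !delV !del.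
exact: (face_condensation w theta_sorted noncrossing ends_e ends_disjoint).
Qed.
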